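(* Let $\mathbf n_\kappa=(n_\kappa(i))_{i\ge 0}$, $\kappa\ge 1$, be degree statistics such that, as $\kappa\to\infty$, $|\mathbf n_\kappa|\to\infty$ and $p_i(\mathbf n_\kappa)=n_\kappa(i)/|\mathbf n_\kappa|\to p_i$ for every $i\ge 0$, where $\mathbf p=(p_i)_{i\ge0}$ is a probability distribution on $\mathbb N_0$. Let $\mathcal T_{\mathbf n_\kappa}\sim\mathrm{Unif}(\mathbb T_{\mathbf n_\kappa})$. Then for every fixed $T\in\mathbb T$, as $\kappa\to\infty$: (i) (Annealed version) $\displaystyle \mathbb P(\mathcal T^{\mathrm{fr}}_{\mathbf n_\kappa}=T)=\frac{\mathbb E[N_T(\mathcal T_{\mathbf n_\kappa})]}{|\mathbf n_\kappa|}\to\pi_{\mathbf p}(T)$. (ii) (Quenched version) $\displaystyle \mathbb P(\mathcal T^{\mathrm{fr}}_{\mathbf n_\kappa}=T\mid \mathcal T_{\mathbf n_\kappa})=\frac{N_T(\mathcal T_{\mathbf n_\kappa})}{|\mathbf n_\kappa|}\to\pi_{\mathbf p}(T)$ in probability. In other words, the random fringe tree converges in distribution as $\kappa\to\infty$: (i) says that $\mathcal T^{\mathrm{fr}}_{\mathbf n_\kappa}$ converges in distribution to $\mathcal T_{\mathbf p}$, and (ii) is the conditional version, that the conditional law $\mathcal L(\mathcal T^{\mathrm{fr}}_{\mathbf n_\kappa}\mid\mathcal T_{\mathbf n_\kappa})$ converges in probability to $\mathcal L(\mathcal T_{\mathbf p})$.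
   Context: $\mathbb N_0=\{0,1,2,\dots\}$. $\mathbb T$ is the (countable) set of all finite plane (i.e. ordered) rooted trees, up to isomorphism. For $T\in\mathbb T$, $|T|$ is its number of vertices, the degree $d_T(v)$ of a vertex $v$ is its number of children, and $n_T(i)$ is the number of vertices of $T$ with exactly $i$ children. A degree statistic is a sequence $\mathbf n=(n(i))_{i\ge0}$ of non-negative integers with $\sum_{i\ge0}n(i)=1+\sum_{i\ge0}i\,n(i)<\infty$; $|\mathbf n|:=\sum_{i\ge0}n(i)$; $\mathbb T_{\mathbf n}$ is the (non-empty, finite) set of $T\in\mathbb T$ with $n_T(i)=n(i)$ for all $i$; $\mathrm{Unif}(\mathbb T_{\mathbf n})$ is the uniform distribution on it. For a vertex $v$ of $T$, the fringe subtree $T_v\in\mathbb T$ is the subtree consisting of $v$ and all its descendants, rooted at $v$. $N_{T'}(T):=|\{v\in T: T_v=T'\}|$. The random fringe subtree $T^{\mathrm{fr}}$ of $T$ is $T_v$ for a uniformly random vertex $v$ of $T$, so $\mathbb P(T^{\mathrm{fr}}=T')=N_{T'}(T)/|T|$; for a random tree $\mathcal T$, $\mathcal T^{\mathrm{fr}}$ is obtained by choosing, given $\mathcal T$, a uniformly random vertex of $\mathcal T$. $\mathcal T_{\mathbf p}$ is a Galton--Watson tree with offspring distribution $\mathbf p$ and $\pi_{\mathbf p}(T):=\mathbb P(\mathcal T_{\mathbf p}=T)=\prod_{i\ge0}p_i^{n_T(i)}$ (with $0^0:=1$). (Under the stated convergence one automatically has $\sum_i ip_i\le 1$.) $\mathcal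 L(X)$ denotes the distribution of $X$. *)

(* Defs.v *)
From HB Require Import structures.
From mathcomp Require Import all_boot all_order all_algebra finmap.
From mathcomp Require Import all_classical all_reals all_analysis.

Set Implicit Arguments.
Unset Strict Implicit.
Unset Printing Implicit Defensive.

Import Order.TTheory GRing.Theory Num.Theory.
Import numFieldNormedType.Exports.

Local Open Scope classical_set_scope.
Local Open Scope ring_scope.

(** * Plane trees *)

(* The finite plane (ordered) rooted trees up to isomorphism: a tree is the
   list of the subtrees hanging from its root, so isomorphism is equality. *)
Inductive ptree : Type := PNode of seq ptree.

Definition children (t : ptree) : seq ptree := let: PNode ts := t in ts.

Section ptree_countable.

Fixpoint ptree_encode (t : ptree) : GenTree.tree void :=
  let: PNode ts := t in GenTree.Node 0 (map ptree_encode ts).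

Fixpoint ptree_decode (g : GenTree.tree void) : ptree :=
  match g with
  | GenTree.Leaf _ => PNode [::]
  | GenTree.Node _ gs => PNode (map ptree_decode gs)
  end.

Lemma ptree_encodeK : cancel ptree_encode ptree_decode.
Proof.
rewrite /cancel; fix IH 1; case=> ts /=; congr PNode.
by elim: ts => //= t ts ->; rewrite IH.
Qed.

End ptree_countable.

HB.instance Definition _ := Countable.copy ptree (can_type ptree_encodeK).
HB.instance Definition _ := isPointed.Build ptree (PNode [::]).
HB.instance Definition _ := @isMeasurable.Build default_measure_display
  ptree discrete_measurable discrete_measurable0
  discrete_measurableC discrete_measurableU.

(* Ulam-Harris addresses: the root is [::], and i :: v is the vertex v of the
   subtree hanging from the i-th child (counted from 0) of the root. *)
Definition address : Type := seq nat.

HB.instance Definition _ := Countable.on address.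
HB.instance Definition _ := isPointed.Build address [::].
HB.instance Definition _ := @isMeasurable.Build default_measure_display
  address discrete_measurable discrete_measurable0
  discrete_measurableC discrete_measurableU.

Fixpoint vertices (t : ptree) : seq address :=
  let: PNode ts := t in
  [::] :: flatten [seq [seq (iv.1 :: v : address) | v <- iv.2]
                  | iv <- zip (iota 0 (size ts)) (map vertices ts)].

(* The value is irrelevant when v is not a vertex of t. *)
Fixpoint fringe (t : ptree) (v : address) : ptree :=
  match v with
  | [::] => t
  | i :: v' => fringe (nth (PNode [::]) (children t) i) v'
  end.

Definition tsize (t : ptree) : nat := size (vertices t).

Definition deg (t : ptree) (v : address) : nat := size (children (fringe t v)).

Definition degcount (t : ptree) (i : nat) : nat :=
  count (fun v => deg t v == i) (vertices t).

Definition fringe_count (t' t : ptree) : nat :=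
  count (fun v => fringe t v == t') (vertices t).

(** * Degree statistics *)

Definition dsize (n : nat -> nat) : nat :=
  \big[addn/0%N]_(i \in [set: nat]) n i.

(* A sum of natural numbers is finite iff it has finitely many nonzero terms;
   the finite-support sums below are meaningful because of the first clause. *)
Definition degree_statistic (n : nat -> nat) : Prop :=
  finite_set [set i | n i != 0%N] /\
  dsize n = (1 + \big[addn/0%N]_(i \in [set: nat]) (i * n i))%N.

Definition trees_with (n : nat -> nat) : set ptree :=
  [set t | forall i, degcount t i = n i].

(** * Laws *)

Definition is_distribution (R : realType) (p : nat -> R) : Prop :=
  (forall i, 0 <= p i) /\ (\sum_(0 <= i <oo) (p i)%:E = 1)%E.

(* All but finitely many factors are p i ^+ 0 = 1, and 0 ^+ 0 = 1. *)
Definition gw_law (R : realType) (p : nat -> R) (t : ptree) : R :=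
  \big[*%R/1]_(i \in [set: nat]) (p i ^+ degcount t i).

Section random_trees.
Context {R : realType} {d : measure_display} {Omega : measurableType d}.
Variable P : probability Omega R.

Definition uniform_on (X : Omega -> ptree) (A : set ptree) : Prop :=
  forall t, P (X @^-1` [set t]) =
    (if t \in A then (#|` fset_set A|%:R)^-1 else 0)%:E.

Definition uniform_vertex (X : Omega -> ptree) (V : Omega -> address) : Prop :=
  forall t v, P (X @^-1` [set t] `&` V @^-1` [set v]) =
    (P (X @^-1` [set t]) *
     (if v \in vertices t then (tsize t)%:R^-1 else 0)%:E)%E.

(* Elementary conditioning on a random tree X. Since X takes countably many
   values, the fibers with probability 0 (where the quotients are junk) form a
   null set, and these are versions of P(A | X) and E[Y | X]. *)
Definition cond_prob (X : Omega -> ptree) (A : set Omega) (w : Omega) : R :=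
  fine (P (A `&` X @^-1` [set X w])) / fine (P (X @^-1` [set X w])).

Definition cond_exp (X : Omega -> ptree) (Y : Omega -> R) (w : Omega) : R :=
  fine (\int[P]_(u in X @^-1` [set X w]) (Y u)%:E)%E
    / fine (P (X @^-1` [set X w])).

End random_trees.

(** * Convergence of random variables living on varying probability spaces *)

Section convergence.
Context {R : realType} {d : nat -> measure_display}.
Context {Omega : forall k, measurableType (d k)}.
Variable P : forall k, probability (Omega k) R.

Definition cvg_in_prob (Y : forall k, Omega k -> R) (c : R) : Prop :=
  forall eps : R, 0 < eps ->
    P k [set w | eps <= `|Y k w - c|] @[k --> \oo] --> 0%E.

Context {d0 : measure_display} {Omega0 : measurableType d0}.
Variables (P0 : probability Omega0 R) (Z0 : Omega0 -> ptree).

(* The set of plane trees is discrete, so every function on it is continuous. *)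
Definition cvg_in_dist (Z : forall k, Omega k -> ptree) : Prop :=
  forall f : ptree -> R, bounded_fun f ->
    'E_(P k)[f \o Z k]%E @[k --> \oo] --> 'E_P0[f \o Z0]%E.

(* The conditional law of Z k given X k converges in probability to the law of
   Z0, for the weak topology on probability measures: its neighbourhoods are
   generated by the integrals of bounded functions, and the integral of f
   against the conditional law is E[f(Z k) | X k]. *)
Definition cond_law_cvg_in_prob (X Z : forall k, Omega k -> ptree) : Prop :=
  forall f : ptree -> R, bounded_fun f ->
    cvg_in_prob (fun k => cond_exp (P k) (X k) (f \o Z k))
      (fine ('E_P0[f \o Z0])%E).

End convergence.

(* Main.v *)
Require Import Defs.
From HB Require Import structures.
From mathcomp Require Import finmap all_boot all_order all_algebra.
From mathcomp Require Import all_classical all_reals all_analysis.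
From mathcomp Require Import measurable_realfun.
From mathcomp Require Import zify ring lra.

Set Implicit Arguments.
Unset Strict Implicit.
Unset Printing Implicit Defensive.

Import Order.TTheory GRing.Theory Num.Theory.
Import numFieldNormedType.Exports.

Local Open Scope classical_set_scope.
Local Open Scope ring_scope.

(** Write [N] for the number of vertices, [s] for the size of the fixed tree [T]
    and [tau i] for the number of its vertices of degree [i].

    A plane forest is explored in depth-first order: passing from
    [PNode ts :: fs] to [ts ++ fs] deletes one vertex, of degree [size ts]. The
    deleted vertex carries the fringe tree [PNode ts], and when this is [T] no
    other vertex of that first tree does. So the [j]-th falling factorial of the
    number of fringe copies of [T], summed over all forests of [k] trees with [n i]
    vertices of each degree [i], obeys a linear recursion in [N], which has
    the explicit solution [k (M + j - 1)! / \prod_i (n i - j tau i)!] with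
    [M = N - j s] ([sum_ffact_forests]). The case [j = 0] counts the forests.
    What makes the induction step close is the relation between the numbers of
    vertices, edges and roots.

    For single trees, [k = 1], dividing the cases [j] and [0] gives the
    factorial moments of the number of copies of [T] in a uniform random tree, as
    [\prod_i (n i)^_(j tau i) / (N - 1)^_(j (s - 1))]
    ([trees_sum_ffact]). If [n i / N] tends to [p i], this is equivalent to
    [N ^ j * (\prod_i p i ^ tau i) ^ j] ([cvg_avg_ffact]). With [j = 1] and
    [j = 2] the proportion of vertices whose fringe tree is [T] converges
    to [gw_law p T] in mean square, hence in mean ([cvg_avg_abs_gw]).

    Everything else follows from convergence in mean. It gives the annealed limit,
    and Markov's inequality gives the quenched one. For a bounded function [f],
    finitely many trees carry all but a small part of the mass of the
    Galton-Watson law; on those the empirical proportions are under control, and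
    their sum controls the rest. So the average of [f] over the fringe trees
    of the random tree converges in mean to its Galton-Watson expectation
    ([cvg_avg_fringes]), which yields both forms of convergence in law. *)

(** * Vertex counts in plane forests *)

Section forests_by_content.
Local Open Scope nat_scope.

Definition fcount (a : pred ptree) (f : seq ptree) : nat :=
  \sum_(t <- f) count (fun v => a (fringe t v)) (vertices t).

(** One step of the exploration deletes the first root and nothing else. *)
Lemma fcount_cons a ts fs :
  fcount a (PNode ts :: fs) = a (PNode ts) + fcount a (ts ++ fs).
Proof.
rewrite /fcount big_cons big_cat /= addnA; congr (_ + _ + _).
suff H pre : count (fun v => a (fringe (PNode (pre ++ ts)) v))
    (flatten [seq [seq (iv.1 :: v : address) | v <- iv.2]
       | iv <- zip (iota (size pre) (size ts)) (map vertices ts)]) =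
    \sum_(t <- ts) count (fun v => a (fringe t v)) (vertices t).
  exact: (H [::]).
elim: ts pre => [|t ts IH] pre /=; first by rewrite big_nil.
rewrite big_cons count_cat count_map; congr (_ + _).
  by apply: eq_count => v /=; rewrite nth_cat ltnn subnn.
rewrite -(IH (rcons pre t)) size_rcons.
by apply: eq_count => v; rewrite cat_rcons.
Qed.

Lemma fcount_nil a : fcount a [::] = 0.
Proof. by rewrite /fcount big_nil. Qed.

Lemma fcount_cat a f g : fcount a (f ++ g) = fcount a f + fcount a g.
Proof. by rewrite /fcount big_cat. Qed.

Lemma fcount1 a t : fcount a [:: t] = count (fun v => a (fringe t v)) (vertices t).
Proof. by rewrite /fcount big_seq1. Qed.

(** Induction along the exploration: it avoids the nested induction on trees,
    and each count of vertices changes in one step by [fcount_cons]. *)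
Lemma forest_ind (Q : seq ptree -> Prop) :
  Q [::] -> (forall ts fs, Q (ts ++ fs) -> Q (PNode ts :: fs)) ->
  forall f, Q f.
Proof.
move=> Q0 QS f; have [m] := ubnP (fcount predT f).
elim: m f => // m IH [|[ts] fs] //; rewrite fcount_cons add1n => lt_m.
exact/QS/IH.
Qed.

Definition has_deg (i : nat) : pred ptree := fun t => size (children t) == i.

Lemma fcount_deg_bound f : exists B, forall i, B <= i -> fcount (has_deg i) f = 0.
Proof.
elim/forest_ind: f => [|ts fs [B HB]].
  by exists 0 => i _; rewrite fcount_nil.
exists (maxn B (size ts).+1) => i; rewrite geq_max => /andP[Bi ti].
by rewrite fcount_cons HB // /has_deg /= ltn_eqF.
Qed.

Lemma sum_pick B (i : nat) (F : nat -> nat) : i < B ->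
  \sum_(j < B) (i == j) * F j = F i.
Proof.
move=> iB; rewrite (bigD1 (Ordinal iB)) //= eqxx mul1n big1 ?addn0 // => j.
by rewrite -val_eqE /= eq_sym => /negbTE ->.
Qed.

Lemma fcount_deg_lt B ts fs :
  (forall i, B <= i -> fcount (has_deg i) (PNode ts :: fs) = 0) ->
  size ts < B /\ (forall i, B <= i -> fcount (has_deg i) (ts ++ fs) = 0).
Proof.
move=> HB; split=> [|i Bi]; last by move: (HB i Bi); rewrite fcount_cons; lia.
rewrite ltnNge; apply/negP => /HB.
by rewrite fcount_cons /has_deg /= eqxx.
Qed.

Lemma sum_fcount_deg B f : (forall i, B <= i -> fcount (has_deg i) f = 0) ->
  \sum_(i < B) fcount (has_deg i) f = fcount predT f.
Proof.
elim/forest_ind: f => [_|ts fs IH /fcount_deg_lt[sB /IH {}IH]].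
  by rewrite big1 ?fcount_nil // => i _; rewrite fcount_nil.
under eq_bigr do rewrite fcount_cons.
rewrite big_split /= IH fcount_cons; congr (_ + _).
rewrite -[RHS](sum_pick (fun=> 1) sB).
by apply: eq_bigr => i _; rewrite muln1.
Qed.

(** Every vertex is a root or a child of exactly one vertex. *)
Lemma sum_deg_fcount_deg B f : (forall i, B <= i -> fcount (has_deg i) f = 0) ->
  \sum_(i < B) i * fcount (has_deg i) f + size f = fcount predT f.
Proof.
elim/forest_ind: f => [_|ts fs IH /fcount_deg_lt[sB /IH {}IH]].
  by rewrite big1 ?fcount_nil // => i _; rewrite fcount_nil muln0.
under eq_bigr do rewrite fcount_cons mulnDr.
rewrite big_split fcount_cons -IH size_cat /=.
suff -> : \sum_(i < B) i * has_deg i (PNode ts) = size ts by rewrite add1n; lia.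
rewrite -[RHS](sum_pick id sB).
by apply: eq_bigr => i _; rewrite mulnC.
Qed.

Lemma tsizeE t : Defs.tsize t = fcount predT [:: t].
Proof. by rewrite fcount1 /Defs.tsize -(count_predT (vertices t)). Qed.

(** A copy of [T] occupies as many vertices as [T] has. *)
Lemma fcount_pred1_small (T : ptree) f :
  fcount predT f < Defs.tsize T -> fcount (pred1 T) f = 0.
Proof.
elim/forest_ind: f => [_|ts fs IH]; first by rewrite fcount_nil.
rewrite !fcount_cons /= => lt_T; rewrite IH ?addn0; last by lia.
case: eqP => // eqT; move: lt_T.
by rewrite -eqT tsizeE !fcount_cons cats0 fcount_cat /=; lia.
Qed.

(** * Enumeration of the forests with given degrees *)

(** Exploring the first root of a forest replaces its first tree, of root
    degree [i], by the [i] subtrees of that root. Read backwards, this builds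
    each forest once from its depth-first sequence of degrees; [N] is the number
    of vertices left and [B] bounds the degrees. *)
Fixpoint forests (B N : nat) (n : nat -> nat) (k : nat) : seq (seq ptree) :=
  match N, k with
  | 0, 0 => [:: [::]]
  | N'.+1, k'.+1 =>
    [seq PNode (take i f) :: drop i f
       | i <- [seq i <- iota 0 B | 0 < n i],
         f <- forests B N' (fun j => n j - (i == j)) (i + k')]
  | _, _ => [::]
  end.

Lemma sum_decr B (n : nat -> nat) i : i < B -> 0 < n i ->
  \sum_(j < B) n j = (\sum_(j < B) (n j - (i == j))).+1.
Proof.
move=> iB ni; rewrite -addn1 -(sum_pick (fun=> 1) iB) -big_split /=.
by apply: eq_bigr => j _; case: eqP => [<-|_]; lia.
Qed.

Lemma mem_forests B (n : nat -> nat) N k f : \sum_(i < B) n i = N ->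
    (forall i, B <= i -> n i = 0) ->
  (f \in forests B N n k) <->
  size f = k /\ forall i, fcount (has_deg i) f = n i.
Proof.
elim: N n k f => [|N IH] n k f sN nB.
  have n0 i : n i = 0.
    case: (leqP B i) => [/nB //|iB].
    by move/eqP: sN; rewrite sum_nat_eq0 => /forallP/(_ (Ordinal iB))/eqP.
  split=> [|[<- H]].
    case: k => //= /[!inE] /eqP ->; split=> // i.
    by rewrite fcount_nil n0.
  case: f H => [_|[ts] fs /(_ (size ts))]; first by rewrite inE.
  by rewrite n0 fcount_cons /has_deg /= eqxx.
case: k => [|k].
  split=> // -[/size0nil -> H].
  by move: sN; rewrite big1 // => i _; rewrite -H fcount_nil.
have dB i j : B <= j -> n j - (i == j) = 0 by move=> /nB ->.
split=> [/allpairsPdep[i [g [/=]]]|].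
  rewrite mem_filter mem_iota add0n /= => /andP[ni iB].
  move: sN; rewrite (sum_decr iB ni) => -[sN].
  move=> /(IH _ _ _ sN (dB i))[sg Hg] ->.
  split=> [|j]; first by rewrite /= size_drop sg addKn.
  rewrite fcount_cons cat_take_drop Hg /has_deg /= size_takel ?sg ?leq_addr //.
  by case: eqP => [<-|_]; rewrite ?subnKC ?subn0.
case: f => [[] //|[ts] fs [[sfs] H]].
have nts : 0 < n (size ts) by rewrite -H fcount_cons /has_deg /= eqxx.
have tsB : size ts < B by rewrite ltnNge; apply/negP => /nB n0; rewrite n0 in nts.
apply/allpairsPdep; exists (size ts), (ts ++ fs); split.
- by rewrite mem_filter nts mem_iota.
- move: sN; rewrite (sum_decr tsB nts) => -[sN].
  apply/(IH _ _ _ sN (dB _)); split=> [|j]; first by rewrite size_cat sfs.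
  by rewrite -H fcount_cons /has_deg /= addKn.
- by rewrite take_size_cat // drop_size_cat.
Qed.

Lemma size_forests B n N k f : f \in forests B N n k -> size f = k.
Proof.
elim: N n k f => [|N IH] n [|k] f //=; first by rewrite inE => /eqP ->.
move=> /allpairsPdep[i [g [/= _ /IH sg ->]]].
by rewrite /= size_drop sg addKn.
Qed.

(** The degree of the first root can be read off the forest, and then so can
    the forest that is left. *)
Lemma uniq_forests B n N k : uniq (forests B N n k).
Proof.
elim: N n k => [|N IH] n [|k] //=.
apply: allpairs_uniq_dep.
- by rewrite filter_uniq ?iota_uniq.
- by move=> i _; exact: IH.
- move=> x y /allpairsPdep[i [f [_ /size_forests sf ->]]].
  move=> /allpairsPdep[j [g [_ /size_forests sg ->]]] /= [et ed].
  have eij : i = j.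
    by have := congr1 size et; rewrite !size_takel ?sf ?sg ?leq_addr.
  by rewrite -(cat_take_drop i f) et ed -eij cat_take_drop.
Qed.

End forests_by_content.

(** * Factorial moments of the number of fringe copies of a tree *)

Section fringe_moments.
Local Open Scope nat_scope.

(** Discrete Leibniz rule: the increment of a falling factorial. *)
Lemma ffactS_add x j : x.+1 ^_ j = x ^_ j + j * x ^_ j.-1.
Proof.
case: j => [|j] //=; rewrite ffactSS ffactnSr.
have [jx|xj] := leqP j x; last by rewrite ffact_small ?muln0.
by rewrite [x ^_ j * _]mulnC -mulnDl; congr (_ * _); lia.
Qed.

Lemma ffactnD x a b : x ^_ (a + b) = x ^_ a * (x - a) ^_ b.
Proof.
elim: b => [|b IH]; first by rewrite addn0 ffactn0 muln1.
by rewrite addnS !ffactnSr IH -mulnA subnDA.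
Qed.

(** This is [k * (x - 1)!]. The value at [x = 0] is the one that makes the number
    of forests with no vertex (one for [k = 0], none otherwise) fit the general
    formula, so that the recursion below has no exceptional case. *)
Definition pointed_fact (k x : nat) : nat := if x is x'.+1 then k * x'`! else k == 0.

(** The recursion over the exploration, after division by the factors that
    depend on the degrees only. Here [m i] stands for [n i - j tau i], the number
    of vertices of degree [i] outside [j] disjoint copies of [T]. *)
Lemma pointed_fact_rec B (m : nat -> nat) j k y :
  \sum_(i < B) i * m i + k.+1 = y.+1 -> \sum_(i < B) m i + j = y.+1 ->
  \sum_(i < B) m i * pointed_fact (i + k) y + j * pointed_fact k y =
  pointed_fact k.+1 y.+1.
Proof.
case: y => [|y] im mj.
  have k0 : k = 0 by lia.
  have /eqP : \sum_(i < B) i * m i = 0 by lia.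
  rewrite sum_nat_eq0 => /forallP im0.
  rewrite /= k0 muln1 -[RHS]mj; congr (_ + _); apply: eq_bigr => i _.
  have := im0 i; rewrite muln_eq0 addn0 => /orP[] /eqP ->; last by rewrite mul0n.
  by rewrite eqxx muln1.
rewrite /pointed_fact.
have -> : \sum_(i < B) m i * ((i + k) * y`!) =
    y`! * (\sum_(i < B) i * m i + k * \sum_(i < B) m i).
  rewrite big_distrr -big_split big_distrr /=.
  by apply: eq_bigr => i _; ring.
rewrite factS; nia.
Qed.

Lemma prod_fact_decr B (n : nat -> nat) i : i < B -> 0 < n i ->
  \prod_(l < B) (n l)`! = n i * \prod_(l < B) (n l - (i == l))`!.
Proof.
move=> iB ni; rewrite (bigD1 (Ordinal iB)) // [in RHS](bigD1 (Ordinal iB)) //=.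
rewrite eqxx mulnA; congr (_ * _); first by case: (n i) ni => // x _; rewrite subn1 factS.
by apply: eq_bigr => l; rewrite -val_eqE /= eq_sym => /negbTE ->; rewrite subn0.
Qed.

(** The factor [n i] is absorbed by [x * (x - 1)^_a = (x - a) * x^_a]. *)
Lemma prod_ffact_decr B (n a : nat -> nat) i : i < B -> 0 < n i ->
  n i * \prod_(l < B) (n l - (i == l)) ^_ (a l) =
  (n i - a i) * \prod_(l < B) (n l) ^_ (a l).
Proof.
move=> iB ni; rewrite (bigD1 (Ordinal iB)) // [in RHS](bigD1 (Ordinal iB)) //=.
rewrite eqxx !mulnA; congr (_ * _).
  by rewrite subn1 -ffactnS ffactnSr mulnC.
by apply: eq_bigr => l; rewrite -val_eqE /= eq_sym => /negbTE ->; rewrite subn0.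
Qed.

Lemma big_forests B N n k (F : seq ptree -> nat) :
  \sum_(f <- forests B N.+1 n k.+1) F f =
  \sum_(i < B | 0 < n i) \sum_(f <- forests B N (fun l => n l - (i == l :> nat)) (i + k))
     F (PNode (take i f) :: drop i f).
Proof.
by rewrite /= big_allpairs_dep /= big_filter -(big_mkord (fun i => 0 < n i)
  (fun i => \sum_(f <- forests B N (fun l => n l - (i == l)) (i + k))
     F (PNode (take i f) :: drop i f))) /index_iota subn0.
Qed.

(** A tree is not a fringe tree of a proper subtree of itself, for lack of
    vertices. Hence two copies of [T] in a forest are disjoint. *)
Lemma fcount_children (T : ptree) : fcount (pred1 T) (children T) = 0.
Proof.
apply: fcount_pred1_small; case: T => ts.
by rewrite tsizeE fcount_cons cats0.
Qed.

(** This is [degcount T i], seen as a count in a forest of one tree. *)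
Definition dcount (T : ptree) i := fcount (has_deg i) [:: T].

Section factorial_moments.
Variables (T : ptree) (B : nat).
Hypothesis T_deg : forall i, B <= i -> dcount T i = 0.

Let s := \sum_(i < B) dcount T i.

(** Effect of one exploration step on the falling factorial. If the first tree is
    [T] itself, its proper subtrees hold no further copy, which is why only [fs]
    remains in the last term. *)
Lemma ffact_pred1_cons ts fs j :
  (fcount (pred1 T) (PNode ts :: fs)) ^_ j =
  (fcount (pred1 T) (ts ++ fs)) ^_ j +
  (PNode ts == T) * (j * (fcount (pred1 T) fs) ^_ j.-1).
Proof.
rewrite fcount_cons /=; case: eqP => [eT|_]; last by rewrite addn0.
rewrite -eT /= add1n ffactS_add mul1n !fcount_cat.
by rewrite -[ts]/(children (PNode ts)) eT fcount_children.
Qed.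

(** Forests starting with [T] are obtained by putting [T] in front of a forest
    that uses the remaining vertices. *)
Lemma sum_forests_head N (n : nat -> nat) k (F : seq ptree -> nat) :
  \sum_(i < B) n i = N -> (forall i, B <= i -> n i = 0) ->
  \sum_(f <- forests B N n k.+1) (head (PNode [::]) f == T) * F (behead f) =
  if [forall i : 'I_B, dcount T i <= n i] then
    \sum_(f <- forests B (N - s) (fun i => n i - dcount T i) k) F f else 0.
Proof.
move=> sN nB.
case: ifP => [/forallP le_n|/negbT]; last first.
  rewrite negb_forall => /existsP[i]; rewrite -ltnNge => lt_n.
  rewrite big_seq big1 // => f /(mem_forests _ _ sN nB)[sf Hf].
  case: f sf Hf => [//|t fs] _ /= Hf; case: eqP => // eT.
  move: lt_n; rewrite -Hf eT ltnNge => /negP[].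
  by rewrite /dcount -[T :: fs]/([:: T] ++ fs) fcount_cat leq_addr.
have {}le_n i : dcount T i <= n i.
  by have [iB|/T_deg ->] := ltnP i B; first exact: (le_n (Ordinal iB)).
have sN' : \sum_(i < B) (n i - dcount T i) = N - s.
  by rewrite /s -sN sumnB.
have nB' i : B <= i -> n i - dcount T i = 0 by move=> /nB ->.
rewrite (eq_bigr (fun f =>
  if head (PNode [::]) f == T then F (behead f) else 0)); last first.
  by move=> f _; case: eqP; rewrite ?mul1n ?mul0n.
rewrite -big_mkcond -big_filter -(big_map behead predT F).
apply: perm_big; apply: uniq_perm; last 1 first.
- move=> g; apply/mapP/idP => [[f]|/(mem_forests _ _ sN' nB')[sg Hg]].
    rewrite mem_filter => /andP[/eqP hf /(mem_forests _ _ sN nB)[sf Hf]] ->.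
    case: f sf Hf hf => [//|t f] /= [sf] Hf eT.
    apply/(mem_forests _ _ sN' nB'); split=> // i.
    by rewrite -Hf eT /dcount -[T :: f]/([:: T] ++ f) fcount_cat addKn.
  exists (T :: g) => //; rewrite mem_filter /= eqxx.
  apply/(mem_forests _ _ sN nB); split=> [|i]; first by rewrite /= sg.
  by rewrite -[T :: g]/([:: T] ++ g) fcount_cat Hg subnKC // le_n.
- rewrite map_inj_in_uniq ?filter_uniq ?uniq_forests // => f g.
  rewrite !mem_filter => /andP[/eqP hf /size_forests sf].
  move=> /andP[/eqP hg /size_forests sg].
  by case: f g sf sg hf hg => [|? ?] [|? ?] //= _ _ -> -> ->.
- exact: uniq_forests.
Qed.

(** Exploring the first root gives [S j n k.+1] as the sum over [i] of
    [S j (n - delta_i) (i + k)], plus [j * S j.-1 (n - tau) k] for the forests that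
    start with [T]. The right-hand side obeys the same recursion by
    [pointed_fact_rec]. The falling factorials vanish as soon as [n] has no room
    for [j] copies of [T]; this takes care of truncated subtraction. *)
Lemma sum_ffact_forests N (n : nat -> nat) k j :
  \sum_(i < B) n i = N -> (forall i, B <= i -> n i = 0) ->
  \sum_(i < B) i * n i + k = N ->
  (\sum_(f <- forests B N n k) (fcount (pred1 T) f) ^_ j)
    * \prod_(i < B) (n i)`! =
  pointed_fact k (N + j - j * s) * \prod_(i < B) (n i) ^_ (j * dcount T i).
Proof.
have s_gt0 : 0 < s.
  by rewrite /s sum_fcount_deg //; case: T => ts; rewrite fcount_cons.
have s_deg : \sum_(i < B) i * dcount T i + 1 = s.
  by rewrite /s sum_fcount_deg // -(sum_deg_fcount_deg T_deg).
elim/ltn_ind: N n k j => N IH n k j sN nB inN.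
(* Either both sides vanish, or all the subtractions below are exact. *)
have le_prod : \prod_(i < B) (n i) ^_ (j * dcount T i) = 0 \/
    forall i, j * dcount T i <= n i.
  have [/forallP le_n|] := boolP [forall i : 'I_B, j * dcount T i <= n i].
    right=> i; have [iB|/T_deg ->] := ltnP i B; first exact: (le_n (Ordinal iB)).
    by rewrite muln0.
  rewrite negb_forall => /existsP[i]; rewrite -ltnNge => lt_n.
  by left; rewrite (bigD1 i) //= ffact_small.
have le_s : (forall i, j * dcount T i <= n i) -> j * s <= N.
  by move=> le_n; rewrite -sN /s big_distrr leq_sum.
case: k => [|k] in inN *.
  case: N => [|N] in sN inN IH le_s *.
    rewrite /= big_seq1 fcount_nil.
    case: j => [|j] in le_prod le_s *; last first.
      rewrite mul0n; case: le_prod => [-> | /le_s]; first by rewrite muln0.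
      by rewrite leqn0 muln_eq0 /=; lia.
    rewrite ffactn0 [pointed_fact _ _](_ : _ = 1) // !mul1n; apply: eq_bigr => i _.
    have /eqP := sN; rewrite sum_nat_eq0 => /forallP/(_ i)/eqP ->.
    by rewrite mul0n.
  rewrite big_nil mul0n; case: le_prod => [-> | /le_s le_sN]; first by rewrite muln0.
  by have -> : N.+1 + j - j * s = (N + j - j * s).+1 by case: (j) le_sN => [|j'] *; lia.
case: N => [|N] in sN inN IH le_s *; first by lia.
pose A := \prod_(i < B) (n i) ^_ (j * dcount T i).
pose y := N + j - j * s.
(* Split each summand according to whether the first tree is T. *)
under eq_big_seq => f /size_forests sf.
  have -> : (fcount (pred1 T) f) ^_ j =
    (fcount (pred1 T) (children (head (PNode [::]) f) ++ behead f)) ^_ j +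
    (head (PNode [::]) f == T) * (j * (fcount (pred1 T) (behead f)) ^_ j.-1).
    by case: f sf => // -[ts] f _; rewrite ffact_pred1_cons.
  over.
rewrite big_split /= mulnDl.
rewrite (big_forests B N n k
  (fun f => (fcount (pred1 T) (children (head (PNode [::]) f) ++ behead f)) ^_ j)).
rewrite (sum_forests_head k (fun f => j * (fcount (pred1 T) f) ^_ j.-1) sN nB).
have -> : (\sum_(i < B | 0 < n i)
    \sum_(f <- forests B N (fun l => n l - (i == l :> nat)) (i + k))
     fcount (pred1 T) (take i f ++ drop i f) ^_ j) * \prod_(i < B) (n i)`! =
    \sum_(i < B) (n i - j * dcount T i) * pointed_fact (i + k) y * A.
  rewrite big_distrl big_mkcond /=; apply: eq_bigr => i _.
  case: ifP => [ni|/negbT]; last by rewrite lt0n negbK => /eqP ->.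
  under eq_bigr do rewrite cat_take_drop.
  have [sN'] : N.+1 = (\sum_(l < B) (n l - (i == l :> nat))).+1.
    by rewrite -sN; exact: sum_decr.
  have inN' : \sum_(l < B) l * (n l - (i == l :> nat)) + (i + k) = N.
    have : \sum_(l < B) l * n l = \sum_(l < B) l * (n l - (i == l :> nat)) + i.
      rewrite -[X in _ = _ + X](sum_pick id (ltn_ord i)) -big_split.
      apply: eq_bigr => l _ /=.
      case: eqP => [<-|_]; last by rewrite subn0 addn0.
      by rewrite mul1n -mulnSr subn1 prednK.
    by lia.
  rewrite (prod_fact_decr (ltn_ord i) ni) mulnCA IH //; last first.
    by move=> l /nB ->.
  rewrite -/y mulnCA (prod_ffact_decr (fun l => j * dcount T l) (ltn_ord i) ni).
  by rewrite mulnCA mulnA.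
have -> : (if [forall i : 'I_B, dcount T i <= n i] then
      \sum_(f <- forests B (N.+1 - s) (fun i => n i - dcount T i) k)
        j * fcount (pred1 T) f ^_ j.-1
    else 0) * \prod_(i < B) (n i)`! = j * pointed_fact k y * A.
  have [j0|j_gt0] := posnP j.
    by rewrite [in RHS]j0 mul0n; case: ifP => // _; rewrite big1 // => f _; rewrite j0.
  case: ifP => [/forallP le_n|/negbT]; last first.
    rewrite negb_forall => /existsP[i]; rewrite -ltnNge => lt_n.
    have -> : A = 0; last by rewrite mul0n muln0.
    rewrite /A (bigD1 i) //= ffact_small ?mul0n //.
    by apply: (leq_trans lt_n); exact: leq_pmull.
  have {}le_n i : dcount T i <= n i.
    by have [iB|/T_deg ->] := ltnP i B; first exact: (le_n (Ordinal iB)).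
  have le_sN : s <= N.+1 by rewrite -sN /s leq_sum.
  have -> : \prod_(i < B) (n i)`! =
      \prod_(i < B) (n i) ^_ (dcount T i) * \prod_(i < B) (n i - dcount T i)`!.
    by rewrite -big_split; apply: eq_bigr => i _ /=; rewrite ffact_fact.
  have -> : A = \prod_(i < B) (n i) ^_ (dcount T i) *
      \prod_(i < B) (n i - dcount T i) ^_ (j.-1 * dcount T i).
    rewrite -big_split; apply: eq_bigr => i _ /=.
    by rewrite -ffactnD -mulSn prednK.
  have -> : y = N.+1 - s + j.-1 - j.-1 * s.
    by rewrite /y -[j in _ - j * _](prednK j_gt0) mulSn; lia.
  rewrite -big_distrr /= mulnCA -mulnA IH; first by ring.
  - by rewrite ltn_subrL s_gt0.
  - by rewrite /s -sN sumnB.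
  - by move=> i /nB ->.
  - have : \sum_(i < B) i * n i =
        \sum_(i < B) i * (n i - dcount T i) + \sum_(i < B) i * dcount T i.
      by rewrite -big_split; apply: eq_bigr => i _ /=; rewrite -mulnDr subnK.
    by lia.
rewrite -big_distrl -mulnDl -/A /=.
case: le_prod => [A0|le_n]; first by rewrite /A A0 !muln0.
have {}le_s := le_s le_n.
have y1 : N.+1 + j - j * s = y.+1 by rewrite /y; case: (j) le_s => [|j'] *; lia.
rewrite y1; congr (_ * _).
apply: (@pointed_fact_rec B (fun i => n i - j * dcount T i)).
- have : \sum_(i < B) i * n i =
      \sum_(i < B) i * (n i - j * dcount T i) + j * \sum_(i < B) i * dcount T i.
    rewrite big_distrr -big_split; apply: eq_bigr => i _ /=.
    by rewrite mulnCA -mulnDr subnK.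
  by move: y1 le_s s_deg inN; nia.
- rewrite sumnB // -big_distrr sN -/s /=; lia.
Qed.
End factorial_moments.

End fringe_moments.

(** * Trees with a given degree statistic *)

Section trees.
Local Open Scope nat_scope.

Definition trees (B : nat) (n : nat -> nat) : seq ptree :=
  [seq head (PNode [::]) f | f <- forests B (\sum_(i < B) n i) n 1].

(** A degree statistic supported below [B], in terms of ordinary finite sums. *)
Definition tree_stat (B : nat) (n : nat -> nat) : Prop :=
  (forall i, B <= i -> n i = 0) /\
  \sum_(i < B) i * n i + 1 = \sum_(i < B) n i.

Variables (B : nat) (n : nat -> nat).
Hypothesis n_stat : tree_stat B n.

Lemma mem_trees t : (t \in trees B n) <-> forall i, degcount t i = n i.
Proof.
have [nB _] := n_stat; split=> [/mapP[f]|Ht].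
  move=> /(mem_forests _ _ erefl nB)[]; case: f => [|u [|]] //= _ Hf -> i.
  by rewrite -Hf fcount1.
apply/mapP; exists [:: t] => //.
by apply/(mem_forests _ _ erefl nB); split=> // i; rewrite fcount1 -Ht.
Qed.

Lemma uniq_trees : uniq (trees B n).
Proof.
rewrite map_inj_in_uniq ?uniq_forests // => f g /size_forests + /size_forests.
by case: f g => [|? []] // [|? []] //= _ _ ->.
Qed.

Lemma sum_trees (F : seq ptree -> nat) :
  \sum_(t <- trees B n) F [:: t] = \sum_(f <- forests B (\sum_(i < B) n i) n 1) F f.
Proof.
rewrite big_map; apply: eq_big_seq => f /size_forests.
by case: f => [|? []].
Qed.

Lemma tsize_trees t : t \in trees B n -> Defs.tsize t = \sum_(i < B) n i.
Proof.
move=> /mem_trees Ht; rewrite tsizeE -(@sum_fcount_deg B).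
  by apply: eq_bigr => i _; rewrite fcount1 -Ht.
by move=> i /n_stat.1 <-; rewrite fcount1 -Ht.
Qed.

(** The case [j = 0] of [sum_ffact_forests], where the tree [T] drops out. *)
Lemma size_trees :
  size (trees B n) * \prod_(i < B) (n i)`! = (\sum_(i < B) n i).-1`!.
Proof.
have [nB n1] := n_stat; set N := \sum_(i < B) n i in n1 *.
have B_gt0 : 0 < B.
  by rewrite lt0n; apply/negP => /eqP B0; move: n1; rewrite /N B0 !big_ord0.
have leaf_deg i : B <= i -> dcount (PNode [::]) i = 0.
  move=> Bi; rewrite /dcount fcount_cons fcount_nil /has_deg /= ltn_eqF //.
  exact: leq_trans B_gt0 Bi.
have := sum_ffact_forests leaf_deg 0 erefl nB n1.
rewrite -(sum_trees (fun f => fcount _ f ^_ 0)) sum1_size -/N => ->.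
rewrite [X in _ * X]big1 ?muln1 => [|i _]; last by rewrite mul0n ffactn0.
by rewrite mul0n subn0 addn0 -n1 addn1 /= mul1n.
Qed.

Lemma size_trees_gt0 : 0 < size (trees B n).
Proof.
by move: (fact_gt0 (\sum_(i < B) n i).-1); rewrite -size_trees muln_gt0 => /andP[].
Qed.

(** The ratio of the cases [j] and [0] of [sum_ffact_forests], without fractions. *)
Lemma trees_sum_ffact (T : ptree) j (c := j * (Defs.tsize T).-1) :
  (forall i, B <= i -> degcount T i = 0) -> c < \sum_(i < B) n i ->
  (\sum_(t <- trees B n) fringe_count T t ^_ j) * (\sum_(i < B) n i).-1 ^_ c =
  size (trees B n) * \prod_(i < B) (n i) ^_ (j * degcount T i).
Proof.
have [nB n1] := n_stat; set N := \sum_(i < B) n i => T_deg lt_c.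
have dE i : dcount T i = degcount T i by rewrite /dcount fcount1.
have T_deg' i : B <= i -> dcount T i = 0 by rewrite dE; apply: T_deg.
have s_gt0 : 0 < Defs.tsize T by case: (T).
have sE : \sum_(i < B) dcount T i = Defs.tsize T by rewrite sum_fcount_deg // tsizeE.
have N_gt0 : 0 < N by rewrite /N -n1 addn1.
have e1 : (\sum_(t <- trees B n) fringe_count T t ^_ j) * \prod_(i < B) (n i)`! =
    pointed_fact 1 (N + j - j * Defs.tsize T) *
    \prod_(i < B) (n i) ^_ (j * degcount T i).
  rewrite -sE; under [X in _ = _ * X]eq_bigr do rewrite -dE.
  rewrite -(sum_ffact_forests T_deg' j erefl nB n1) -sum_trees.
  by congr (_ * _); apply: eq_bigr => t _; rewrite fcount1.
have xE : N + j - j * Defs.tsize T = (N.-1 - c).+1.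
  by rewrite -[X in j * X](prednK s_gt0) mulnS; move: lt_c; rewrite /c; lia.
rewrite xE /= mul1n in e1.
have cN : c <= N.-1 by lia.
have n_gt0 : 0 < \prod_(i < B) (n i)`! by apply: prodn_gt0 => i; exact: fact_gt0.
apply/eqP; rewrite -(eqn_pmul2r n_gt0) mulnAC e1 [X in _ == X]mulnAC size_trees.
by rewrite -(ffact_fact cN); apply/eqP; ring.
Qed.

End trees.

(** * Asymptotics of the moments *)

Section avg.
Variable R : realType.
Implicit Types (T : Type) (c : R).

Definition avg T (g : T -> R) (l : seq T) : R :=
  (\sum_(t <- l) g t) / (size l)%:R.

Lemma avg_cst T c (l : seq T) : (0 < size l)%N -> avg (fun=> c) l = c.
Proof.
move=> l0; rewrite /avg big_const_seq count_predT iter_addr_0 -[_ *+ _]mulr_natr.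
by rewrite mulfK // pnatr_eq0 -lt0n.
Qed.

Lemma avgD T (f g : T -> R) l : avg (fun t => f t + g t) l = avg f l + avg g l.
Proof. by rewrite /avg big_split mulrDl. Qed.

Lemma avgZ T c (f : T -> R) l : avg (fun t => c * f t) l = c * avg f l.
Proof. by rewrite /avg -mulr_sumr mulrA. Qed.

Lemma avg_sum T (I : Type) (K : seq I) (f : I -> T -> R) l :
  avg (fun t => \sum_(i <- K) f i t) l = \sum_(i <- K) avg (f i) l.
Proof. by rewrite /avg exchange_big mulr_suml. Qed.

Lemma ler_avg (T : eqType) (f g : T -> R) l :
  {in l, forall t, f t <= g t} -> avg f l <= avg g l.
Proof.
move=> fg; rewrite /avg ler_wpM2r ?invr_ge0 // big_seq [leRHS]big_seq.
exact: ler_sum.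
Qed.

Lemma ler_norm_avg T (f : T -> R) l : `|avg f l| <= avg (fun t => `|f t|) l.
Proof.
rewrite /avg normrM [X in _ * X]ger0_norm ?invr_ge0 // ler_wpM2r ?invr_ge0 //.
exact: ler_norm_sum.
Qed.

Lemma eq_avg (T : eqType) (f g : T -> R) l : {in l, f =1 g} -> avg f l = avg g l.
Proof. by move=> fg; congr (_ / _); exact: eq_big_seq. Qed.

Lemma perm_avg (T : eqType) (f : T -> R) l1 l2 :
  perm_eq l1 l2 -> avg f l1 = avg f l2.
Proof. by move=> l12; rewrite /avg (perm_big _ l12) (perm_size l12). Qed.

End avg.

Section asymptotics.
Variable R : realType.

Variable N : nat -> nat.
Hypothesis N_cvg : N k @[k --> \oo] --> \oo.

Lemma cvg_inv_size : (N k)%:R^-1 @[k --> \oo] --> (0 : R).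
Proof.
have : (fun m : nat => m%:R^-1 : R) @ \oo --> (0 : R).
  by rewrite -cvg_shiftS; exact: cvg_harmonic.
exact: cvg_comp.
Qed.

(** A bounded shift is negligible at scale [N k]. *)
Lemma cvg_subn (x : nat -> nat) (l : R) (a : nat) :
  (x k)%:R / (N k)%:R @[k --> \oo] --> l ->
  (x k - a)%:R / (N k)%:R @[k --> \oo] --> l.
Proof.
move=> x_cvg.
have lo : (x k)%:R / (N k)%:R - a%:R * (N k)%:R^-1 @[k --> \oo] --> l.
  rewrite -[l]subr0 -(mulr0 a%:R); apply: cvgB => //.
  by apply: cvgM; [exact: cvg_cst|exact: cvg_inv_size].
apply: squeeze_cvgr lo x_cvg; apply: nearW => k.
rewrite -mulrBl; apply/andP; split; apply: ler_wpM2r; rewrite ?invr_ge0 ?ler0n //.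
  by rewrite lerBlDr -natrD ler_nat; lia.
by rewrite ler_nat leq_subr.
Qed.

Lemma cvg_ffact (x : nat -> nat) (l : R) (a : nat) :
  (x k)%:R / (N k)%:R @[k --> \oo] --> l ->
  (x k ^_ a)%:R / (N k)%:R ^+ a @[k --> \oo] --> l ^+ a.
Proof.
move=> x_cvg; elim: a => [|a IH].
  under eq_fun do rewrite ffactn0 !expr0 divr1.
  exact: cvg_cst.
rewrite exprSr.
have -> : (fun k => (x k ^_ a.+1)%:R / (N k)%:R ^+ a.+1) =
    (fun k => (x k ^_ a)%:R / (N k)%:R ^+ a * ((x k - a)%:R / (N k)%:R)) :> (nat -> R).
  by apply/funext => k; rewrite ffactnSr natrM exprSr invfM mulrACA.
by apply: cvgM => //; exact: cvg_subn.
Qed.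

Variables (n : nat -> nat -> nat) (B : nat -> nat) (p : nat -> R).
Hypothesis n_cvg : forall i, (n k i)%:R / (N k)%:R @[k --> \oo] --> p i.
Hypothesis n_stat : forall k, (0 < k)%N -> tree_stat (B k) (n k).
Hypothesis n_size : forall k, (0 < k)%N -> N k = (\sum_(i < B k) n k i)%N.

Variables (T : ptree) (BT : nat).
Hypothesis T_deg : forall i, (BT <= i)%N -> degcount T i = 0%N.
Hypothesis le_B : forall k, (0 < k)%N -> (BT <= B k)%N.

Let L k := trees (B k) (n k).
Let pi := \prod_(i < BT) p i ^+ degcount T i.

(** The bound [BT] on the degrees of [T] does not depend on [k], unlike [B k];
    this keeps the number of factors fixed in the limit. *)
Lemma avg_trees_ffact k j (c := (j * (Defs.tsize T).-1)%N) :
  (0 < k)%N -> (c < N k)%N ->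
  avg (fun t => (fringe_count T t ^_ j)%:R : R) (L k) =
  (\prod_(i < BT) (n k i ^_ (j * degcount T i))%:R) / ((N k).-1 ^_ c)%:R.
Proof.
move=> k0 cN.
have L0 := size_trees_gt0 (n_stat k0).
have := trees_sum_ffact (T := T) (j := j) (n_stat k0).
rewrite -n_size // => /(_ _ cN).
have T_deg' i : (B k <= i)%N -> degcount T i = 0%N.
  by move=> Bi; rewrite T_deg // (leq_trans (le_B k0)).
move=> /(_ T_deg') /(congr1 (fun x => x%:R : R)); rewrite !natrM natr_sum => e.
rewrite /avg; apply/eqP; rewrite eqr_div ?pnatr_eq0 -?lt0n //; last first.
  by rewrite ffact_gt0; lia.
rewrite e mulrC; apply/eqP; congr (_ * _).
rewrite natr_prod [in RHS](big_ord_widen (B k)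
  (fun i => (n k i ^_ (j * degcount T i))%:R)) ?le_B //.
rewrite [RHS]big_mkcond; apply: eq_bigr => i _; case: ltnP => // /T_deg ->.
by rewrite muln0 ffactn0.
Qed.

Lemma cvg_avg_ffact j :
  avg (fun t => (fringe_count T t ^_ j)%:R : R) (L k) / (N k)%:R ^+ j
    @[k --> \oo] --> pi ^+ j.
Proof.
pose c := (j * (Defs.tsize T).-1)%N.
have N_gt0 : \forall k \near \oo, (c < N k)%N.
  exact: (N_cvg (nbhs_infty_gt c)).
have one_cvg : (N k)%:R / (N k)%:R @[k --> \oo] --> (1 : R).
  apply: cvg_near_cst; near=> k; rewrite divff // pnatr_eq0 -lt0n.
  by apply: (@leq_ltn_trans c) => //; near: k.
have cvg_den : ((N k).-1 ^_ c)%:R / (N k)%:R ^+ c @[k --> \oo] --> (1 : R).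
  rewrite -[X in _ --> X](expr1n _ c); apply: cvg_ffact.
  under eq_fun do rewrite -subn1.
  exact: cvg_subn.
have cvg_num : \prod_(i < BT) ((n k i ^_ (j * degcount T i))%:R /
    (N k)%:R ^+ (j * degcount T i)) @[k --> \oo] --> pi ^+ j.
  rewrite -prodrXl.
  apply: cvg_big => [|i _]; first exact: mul_continuous.
  by rewrite -exprM mulnC; exact: cvg_ffact.
rewrite -[pi ^+ j]mulr1 -[X in _ * X]invr1.
apply: cvg_trans (cvgM cvg_num (cvgV (oner_neq0 R) cvg_den)).
apply: near_eq_cvg; near=> k => /=.
have kc : (c < N k)%N by near: k.
have N0 : (N k)%:R != 0 :> R by rewrite pnatr_eq0 -lt0n (leq_ltn_trans _ kc).
rewrite avg_trees_ffact //; last by near: k; exact: nbhs_infty_gt.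
have M0 : ((N k).-1 ^_ c)%:R != 0 :> R by rewrite pnatr_eq0 -lt0n ffact_gt0; lia.
rewrite -/c prodf_div prodrXr -big_distrr /=.
have -> : \sum_(i < BT) degcount T i = Defs.tsize T.
  rewrite tsizeE -(@sum_fcount_deg BT) => [|i /T_deg]; last by rewrite fcount1.
  by apply: eq_bigr => i _; rewrite fcount1.
have -> : (j * Defs.tsize T = j + c)%N by rewrite -mulnS prednK //; case: (T).
by rewrite exprD; field; rewrite M0 !expf_neq0.
Unshelve. all: by end_near. Qed.

Lemma cvg_avg_fringe :
  avg (fun t => (fringe_count T t)%:R / (N k)%:R : R) (L k) @[k --> \oo] --> pi.
Proof.
have -> : (fun k => avg (fun t => (fringe_count T t)%:R / (N k)%:R : R) (L k)) =
    (fun k => avg (fun t => (fringe_count T t ^_ 1)%:R) (L k) / (N k)%:R ^+ 1).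
  apply/funext => k.
  rewrite /avg -mulr_suml expr1 mulrAC; congr (_ / _ / _).
  by apply: eq_bigr => t _; rewrite ffactn1.
by rewrite -[pi]expr1; exact: cvg_avg_ffact.
Qed.

(** The square is expanded with [x ^ 2 = x^_2 + x]; the extra term [x] is of lower
    order after division by [N ^ 2]. *)
Lemma cvg_avg_sqr :
  avg (fun t => ((fringe_count T t)%:R / (N k)%:R - pi) ^+ 2) (L k) @[k --> \oo] --> 0.
Proof.
have cvg2 := @cvg_avg_ffact 2.
have cvg1 := cvg_avg_fringe.
rewrite -[X in _ --> X](_ : pi ^+ 2 + pi * 0 - 2 * pi * pi + pi ^+ 2 = 0); last by ring.
apply: cvg_trans (cvgD (cvgB (cvgD cvg2 (cvgM cvg1 cvg_inv_size))
  (cvgM (cvg_cst (2 * pi)) cvg1)) (cvg_cst (pi ^+ 2))).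
apply: near_eq_cvg; near=> k; rewrite !fctE /=.
have k0 : (0 < k)%N by near: k; exact: nbhs_infty_gt.
have L0 : (size (L k))%:R != 0 :> R.
  by rewrite pnatr_eq0 -lt0n size_trees_gt0 //; exact: n_stat.
set a := (N k)%:R^-1; pose x t : R := (fringe_count T t)%:R.
have -> : (N k)%:R ^- 2 = a ^+ 2 by rewrite exprVn.
suff E : \sum_(t <- L k) (x t * a - pi) ^+ 2 =
    (\sum_(t <- L k) (fringe_count T t ^_ 2)%:R) * a ^+ 2 +
    (\sum_(t <- L k) x t * a) * a - 2 * pi * (\sum_(t <- L k) x t * a) +
    (size (L k))%:R * pi ^+ 2.
  by rewrite /avg E /x; field.
have -> : (size (L k))%:R * pi ^+ 2 = \sum_(t <- L k) pi ^+ 2.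
  by rewrite big_const_seq count_predT iter_addr_0 mulr_natl.
rewrite !mulr_suml mulr_sumr -big_split -sumrB -big_split; apply: eq_bigr => t _ /=.
have -> : (fringe_count T t ^_ 2)%:R = x t * (x t - 1).
  rewrite /x ffactnSr ffactn1; case: (fringe_count T t) => [|m]; first by rewrite !mul0r.
  by rewrite natrM subn1 /= -(natrB _ (ltn0Sn m)) subn1.
by ring.
Unshelve. all: by end_near. Qed.
End asymptotics.

(** From sums and products over all of [nat], which are finitely supported, to
    ordinary finite ones. *)
Lemma fsbig_setT_ord (S : Type) (idx : S) (op : Monoid.com_law idx) B (F : nat -> S) :
  (forall i, (B <= i)%N -> F i = idx) ->
  \big[op/idx]_(i \in [set: nat]) F i = \big[op/idx]_(i < B) F i.
Proof.
move=> FB; rewrite fsbig_ord; apply/esym/fsbig_widen => // i [_ /= /negP].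
by rewrite -leqNgt => /FB.
Qed.

Lemma degree_statistic_bound n : degree_statistic n ->
  exists B0, forall B, (B0 <= B)%N ->
    tree_stat B n /\ dsize n = (\sum_(i < B) n i)%N.
Proof.
move=> [/finite_seqP[s sE] n1].
have nB i : ((\max_(j <- s) j).+1 <= i)%N -> n i = 0%N.
  move=> lti; apply/eqP/negPn/negP => ni0; move: lti; rewrite ltnNge => /negP; apply.
  suff si : i \in s by exact: leq_bigmax_seq.
  by have : [set` s] i by rewrite -sE.
exists (\max_(j <- s) j).+1 => B leB.
have nB' i : (B <= i)%N -> n i = 0%N by move=> /(leq_trans leB); exact: nB.
have dE : dsize n = (\sum_(i < B) n i)%N by apply: fsbig_setT_ord.
split=> //; split=> //; rewrite -dE n1 addnC; congr (_ + _)%N.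
by apply/esym/fsbig_setT_ord => i /nB' ->; rewrite muln0.
Qed.

Lemma degcount_bound (T : ptree) :
  exists BT, forall i, (BT <= i)%N -> degcount T i = 0%N.
Proof.
have [B HB] := fcount_deg_bound [:: T].
by exists B => i /HB; rewrite fcount1.
Qed.

(** * Convergence in mean of the fringe proportions *)

Section quenched.
Variables (R : realType) (n : nat -> nat -> nat) (p : nat -> R) (L : nat -> seq ptree).
Hypothesis n_stat : forall k, (0 < k)%N -> degree_statistic (n k).
Hypothesis n_size : dsize (n k) @[k --> \oo] --> \oo.
Hypothesis n_cvg : forall i, (n k i)%:R / (dsize (n k))%:R @[k --> \oo] --> p i.
Hypothesis L_uniq : forall k, (0 < k)%N -> uniq (L k).
Hypothesis mem_L : forall k, (0 < k)%N -> forall t, t \in L k <-> trees_with (n k) t.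

(** The averages depend on the list [L k] only up to order, so the bound [B k] of
    the enumeration may be chosen large enough for the fixed tree [T]. *)
Lemma cvg_avg_sqr_gw (T : ptree) :
  avg (fun t => ((fringe_count T t)%:R / (dsize (n k))%:R - gw_law p T) ^+ 2) (L k)
    @[k --> \oo] --> 0.
Proof.
have [BT T_deg] := degcount_bound T.
have /choice[B0 HB0] : forall k, exists B0, (0 < k)%N -> forall B, (B0 <= B)%N ->
    tree_stat B (n k) /\ dsize (n k) = (\sum_(i < B) n k i)%N.
  move=> k; case: (posnP k) => [->|/n_stat/degree_statistic_bound[B0]].
    by exists 0%N.
  by exists B0.
pose B k := maxn BT (B0 k).
have stat k : (0 < k)%N -> tree_stat (B k) (n k).
  by move=> /HB0/(_ (B k))[]; rewrite ?leq_maxr.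
have size k : (0 < k)%N -> dsize (n k) = (\sum_(i < B k) n k i)%N.
  by move=> /HB0/(_ (B k))[]; rewrite ?leq_maxr.
have BTB k : (0 < k)%N -> (BT <= B k)%N by rewrite leq_maxl.
have -> : gw_law p T = \prod_(i < BT) p i ^+ degcount T i.
  by apply: fsbig_setT_ord => i /T_deg ->.
apply: cvg_trans (cvg_avg_sqr n_size n_cvg stat size T_deg BTB).
apply: near_eq_cvg; near=> k; apply: perm_avg.
have k0 : (0 < k)%N by near: k; exact: nbhs_infty_gt.
apply: uniq_perm; [exact: uniq_trees | exact: L_uniq | move=> t].
apply/idP/idP => [/(mem_trees (stat _ k0)) Ht|/(mem_L k0) Ht]; first exact/(mem_L k0).
exact/(mem_trees (stat _ k0)).
Unshelve. all: by end_near. Qed.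

Lemma size_L_gt0 k : (0 < k)%N -> (0 < size (L k))%N.
Proof.
move=> k0; have [B /(_ B (leqnn B))[stat _]] := degree_statistic_bound (n_stat k0).
have := size_trees_gt0 stat; rewrite -has_predT => /hasP[t].
move=> /(mem_trees stat)/(mem_L k0) tL _.
by rewrite lt0n size_eq0; case: (L k) tL.
Qed.

Lemma tsize_L k t : (0 < k)%N -> t \in L k -> Defs.tsize t = dsize (n k).
Proof.
move=> k0 /(mem_L k0) Ht.
have [B /(_ B (leqnn B))[stat ->]] := degree_statistic_bound (n_stat k0).
exact/(tsize_trees stat)/(mem_trees stat).
Qed.

(** Mean-square convergence implies convergence in mean, by the inequality
    [|x| <= e / 2 + x ^ 2 / (2 e)]. *)
Lemma cvg_avg_abs_gw (T : ptree) :
  avg (fun t => `|(fringe_count T t)%:R / (dsize (n k))%:R - gw_law p T|) (L k)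
    @[k --> \oo] --> 0.
Proof.
apply/cvgr0Pnorm_le => e e0.
pose x k t := (fringe_count T t)%:R / (dsize (n k))%:R - gw_law p T.
have := cvg_avg_sqr_gw T => /cvgr0Pnorm_le /(_ (e ^+ 2)) H.
near=> k.
have k0 : (0 < k)%N by near: k; exact: nbhs_infty_gt.
have : `|avg (fun t => x k t ^+ 2) (L k)| <= e ^+ 2.
  by near: k; apply: H; rewrite exprn_gt0.
rewrite [X in X <= _ -> _]ger0_norm.
  2: by rewrite mulr_ge0 ?invr_ge0 // sumr_ge0 // => t _; rewrite sqr_ge0.
rewrite [X in _ -> X <= _]ger0_norm.
  2: by rewrite mulr_ge0 ?invr_ge0 // sumr_ge0.
move=> H2.
apply: (@le_trans _ _ (avg (fun t => e / 2 + (2 * e)^-1 * x k t ^+ 2) (L k))).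
  apply: ler_avg => t _; rewrite -/(x k t).
  rewrite -(real_normK (num_real (x k t))); move: `|x k t| => y.
  rewrite -subr_ge0 (_ : _ - _ = (2 * e)^-1 * (y - e) ^+ 2).
    by rewrite mulr_ge0 ?sqr_ge0 // invr_ge0 mulr_ge0 // ltW.
  by field; rewrite gt_eqF.
rewrite avgD [X in _ + X]avgZ avg_cst ?size_L_gt0 //.
apply: (@le_trans _ _ (e / 2 + (2 * e)^-1 * e ^+ 2)).
  by rewrite lerD2l ler_wpM2l // invr_ge0 mulr_ge0 // ltW.
rewrite le_eqVlt; apply/orP; left; apply/eqP; field; by rewrite gt_eqF.
Unshelve. all: by end_near. Qed.

End quenched.

(** * Discrete random variables *)

Section discrete.
Context {R : realType} {d : measure_display} {Omega : measurableType d}.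
Variables (P : probability Omega R) (S : countType) (W : Omega -> S).
Hypothesis mW : forall s, measurable (W @^-1` [set s]).

Lemma measurable_preimage_discrete (A : set S) : measurable (W @^-1` A).
Proof.
have -> : W @^-1` A =
    \bigcup_i (if @pickle_inv S i is Some s then [set w | A s /\ W w = s] else set0).
  apply/seteqP; split=> [w Aw|w [i _]].
    by exists (pickle (W w)); rewrite ?pickleK_inv.
  by case: pickle_inv => // s [As Ws]; rewrite /preimage /= Ws.
apply: bigcupT_measurable => i; case: pickle_inv => [s|]; last exact: measurable0.
have [As|nAs] := pselect (A s).
  rewrite (_ : [set _ | _] = W @^-1` [set s]); first exact: mW.
  by apply/seteqP; split=> [w []|w].
rewrite (_ : [set _ | _] = set0); first exact: measurable0.
by apply/seteqP; split=> [w []|w].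
Qed.

Lemma measurable_comp_discrete (D : set Omega) (g : S -> R) :
  measurable_fun D (fun w => g (W w)).
Proof.
move=> mD Y mY; apply: measurableI => //.
exact: (measurable_preimage_discrete (g @^-1` Y)).
Qed.

(** The variable [g (W w)], replaced by zero outside the event that [W] lies
    in [l], as a finite combination of indicators: its integral is a finite sum. *)
Definition finite_part (l : seq S) (g : S -> R) (w : Omega) : R :=
  \sum_(s <- l) g s * \1_(W @^-1` [set s]) w.

Lemma finite_partE l g w : uniq l ->
  finite_part l g w = if W w \in l then g (W w) else 0.
Proof.
rewrite /finite_part; elim: l => [|s l IH] /=; first by rewrite big_nil.
move=> /andP[sl /IH {}IH]; rewrite big_cons IH inE indicE.
have [Ws|Ws] := eqVneq (W w) s.
  by rewrite mem_set //= mulr1 Ws (negbTE sl) addr0.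
by rewrite memNset ?mulr0 ?add0r //=; exact/eqP.
Qed.

Lemma integrable_preimage (D : set Omega) s : measurable D ->
  P.-integrable D (fun w => (\1_(W @^-1` [set s]) w)%:E).
Proof.
by move=> mD; apply: (integrableS measurableT) => //; exact: integrable_indic.
Qed.

Lemma integrable_finite_term (D : set Omega) (g : S -> R) s : measurable D ->
  P.-integrable D (fun w => (g s * \1_(W @^-1` [set s]) w)%:E).
Proof.
move=> mD.
apply: (eq_integrable mD (fun w => (g s)%:E * (\1_(W @^-1` [set s]) w)%:E)%E).
  by move=> w _; rewrite EFinM.
by apply: integrableZl => //; exact: integrable_preimage.
Qed.

Lemma integrable_finite_part (D : set Omega) l g : measurable D ->
  P.-integrable D (fun w => (finite_part l g w)%:E).
Proof.
move=> mD; under eq_fun do rewrite /finite_part -sumEFin.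
by apply: integrable_sum => // s _; exact: integrable_finite_term.
Qed.

Lemma integral_finite_part (D : set Omega) l g : measurable D ->
  (\int[P]_(w in D) (finite_part l g w)%:E =
   \sum_(s <- l) (g s)%:E * P (W @^-1` [set s] `&` D))%E.
Proof.
move=> mD; under eq_integral do rewrite /finite_part -sumEFin.
rewrite integral_sum //.
  apply: eq_bigr => s _; under eq_integral do rewrite EFinM.
  by rewrite integralZl ?integral_indic //; exact: integrable_preimage.
move=> s; exact: integrable_finite_term.
Qed.

Lemma integrable_bounded g (C : R) : (forall s, `|g s| <= C) ->
  P.-integrable setT (fun w => (g (W w))%:E).
Proof.
move=> gC; apply: measurable_bounded_integrable => //.
- by rewrite -ge0_fin_numE // fin_num_measure.
- exact: measurable_comp_discrete.
- exists C; split=> [|M CM w _]; first exact: num_real.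
  exact: le_trans (gC _) (ltW CM).
Qed.

Definition pmass (s : S) : R := fine (P (W @^-1` [set s])).

Lemma pmassK s : (pmass s)%:E = P (W @^-1` [set s]).
Proof. by rewrite fineK // fin_num_measure. Qed.

(** Bound [g] by [C] off the list [l]. *)
Lemma expectation_le_head g C l : uniq l -> (forall s, `|g s| <= C) ->
  ('E_P[fun w => (g (W w))%R] <= (C + \sum_(s <- l) (g s - C) * pmass s)%:E)%E.
Proof.
move=> ul gC; rewrite unlock.
apply: (@le_trans _ _
  (\int[P]_(w in setT) (C%:E + (finite_part l (fun s => g s - C) w)%:E))%E).
  apply: le_integral => //.
  - exact: integrable_bounded gC.
  - apply: integrableD => //; first exact: finite_measure_integrable_cst.
    exact: integrable_finite_part.
  - move=> w _; rewrite -EFinD lee_fin finite_partE //.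
    case: ifP => _; first by rewrite addrC subrK.
    by rewrite addr0; apply: le_trans (gC _); exact: ler_norm.
rewrite integralD //; first last.
- exact: integrable_finite_part.
- exact: finite_measure_integrable_cst.
rewrite integral_cst // [X in (C%:E * X)%E](probability_setT P) mule1.
rewrite integral_finite_part // EFinD -sumEFin.
rewrite leeD2l //; under eq_bigr do rewrite setIT -pmassK.
by [].
Qed.

(** The previous bound for [g] and for [- g]. *)
Lemma expectation_head g C l : uniq l -> (forall s, `|g s| <= C) ->
  `|fine ('E_P[fun w => (g (W w))%R])%E - \sum_(s <- l) g s * pmass s| <=
  C * (1 - \sum_(s <- l) pmass s).
Proof.
move=> ul gC.
have fin f : (forall s, `|f s| <= C) -> ('E_P[fun w => (f (W w))%R])%E \is a fin_num.
  move=> fC; rewrite unlock; apply: integrable_fin_num => //.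
  exact: integrable_bounded fC.
have upper f : (forall s, `|f s| <= C) -> fine ('E_P[fun w => (f (W w))%R])%E -
    \sum_(s <- l) f s * pmass s <= C * (1 - \sum_(s <- l) pmass s).
  move=> fC; have := expectation_le_head ul fC.
  rewrite -(fineK (fin f fC)) lee_fin; under eq_bigr do rewrite mulrBl.
  by rewrite sumrB -mulr_sumr; lra.
rewrite ler_norml upper // andbT.
have := upper (fun s => - g s).
rewrite (_ : fine _ = - fine ('E_P[fun w => (g (W w))%R])%E).
  under eq_bigr do rewrite mulNr.
  rewrite sumrN => H.
  by have := H (fun s => eq_ind_r (fun x => x <= C) (gC s) (normrN _)); lra.
rewrite -fineN; congr fine; rewrite unlock -mulN1e -integralZl //.
  by apply: eq_integral => w _; rewrite -EFinM mulN1r.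
exact: integrable_bounded gC.
Qed.

(** A law on a countable type is tight: finite initial segments of an
    enumeration exhaust the space. *)
Lemma exists_head (e : R) : 0 < e ->
  exists2 l, uniq l & 1 - e < \sum_(s <- l) pmass s.
Proof.
move=> e0; pose F m := [set w | (pickle (W w) < m)%N].
have FE m : F m = W @^-1` [set s | (pickle s < m)%N] by [].
have mF m : measurable (F m) by rewrite FE; exact: measurable_preimage_discrete.
have F_cvg : P (F m) @[m --> \oo] --> 1%E.
  rewrite -(probability_setT P) (_ : setT = \bigcup_m F m); last first.
    by apply/seteqP; split=> // w _; exists (pickle (W w)).+1 => //=; exact: ltnSn.
  apply: nondecreasing_cvg_mu => //; first exact: bigcupT_measurable.
  by apply/nondecreasing_seqP => m; apply/subsetPset => w /= /ltnW.
pose l m := pmap (@pickle_inv S) (iota 0 m).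
have ul m : uniq (l m) by apply: (pmap_uniq (@pickle_invK S)); exact: iota_uniq.
have lE m : P (F m) = (\sum_(s <- l m) pmass s)%:E.
  rewrite -[F m]setIT -(integral_indic P measurableT (mF m)).
  transitivity (\int[P]_(w in setT) (finite_part (l m) (fun=> 1) w)%:E)%E.
    apply: eq_integral => w _; rewrite finite_partE // indicE.
    have -> : (W w \in l m) = (pickle (W w) < m)%N.
      by rewrite (can2_mem_pmap pickle_invK pickleK_inv) mem_iota add0n.
    by case: ifP => Wl; [rewrite mem_set|rewrite memNset // /F /= Wl].
  rewrite integral_finite_part // -sumEFin; apply: eq_bigr => s _.
  by rewrite mul1e setIT pmassK.
have sum_cvg : \sum_(s <- l m) pmass s @[m --> \oo] --> (1 : R).
  by move: F_cvg; under eq_fun do rewrite lE; move=> /fine_cvgP[].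
have lt_e : 1 - e < 1 by rewrite ltrBlDr ltrDl.
have [m _ /(_ m (leqnn m)) /=] := cvgr_gt _ sum_cvg (1 - e) lt_e.
by exists (l m).
Qed.

Section uniform.
Variable l : seq S.
Hypothesis l_uniq : uniq l.
Hypothesis l_gt0 : (0 < size l)%N.
Hypothesis W_unif : forall s, s \in l -> P (W @^-1` [set s]) = ((size l)%:R^-1)%:E.

Let size_neq0 : (size l)%:R != 0 :> R.
Proof. by rewrite pnatr_eq0 -lt0n. Qed.

(** The masses on [l] add up to one. *)
Lemma uniform_support : P (~` (W @^-1` [set` l])) = 0%E.
Proof.
rewrite probability_setC; last exact: measurable_preimage_discrete.
suff -> : P (W @^-1` [set` l]) = 1%E by rewrite subee.
rewrite -[W @^-1` _]setIT.
rewrite -(integral_indic P measurableT (measurable_preimage_discrete _)).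
transitivity (\int[P]_(w in setT) (finite_part l (fun=> 1) w)%:E)%E.
  apply: eq_integral => w _; rewrite finite_partE // indicE.
  by case: ifP => Wl; [rewrite mem_set|rewrite memNset //= Wl].
rewrite integral_finite_part //.
under eq_big_seq => s /W_unif e do rewrite mul1e setIT e.
rewrite sumEFin big_const_seq count_predT iter_addr_0 -[_ *+ _]mulr_natl.
by rewrite divff.
Qed.

(** [g] may be unbounded off the list, where [W] has probability zero: the
    integrand is replaced by its [finite_part], to which it is almost surely
    equal. *)
Lemma integral_uniform_seq (A : pred S) (g : S -> R) :
  (\int[P]_(w in W @^-1` [set s | A s]) (g (W w))%:E =
   ((\sum_(s <- l | A s) g s) / (size l)%:R)%:E)%E.
Proof.
have mA := measurable_preimage_discrete [set s | A s].
transitivity (\int[P]_(w in W @^-1` [set s | A s]) (finite_part l g w)%:E)%E.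
  apply: ae_eq_integral => //.
  - by apply/measurable_EFinP; exact: measurable_comp_discrete.
  - apply/measurable_EFinP.
    rewrite (_ : finite_part l g = fun w => if W w \in l then g (W w) else 0).
      2: by apply/funext => w; rewrite finite_partE.
    exact: (@measurable_comp_discrete _ (fun s => if s \in l then g s else 0)).
  - exists (~` (W @^-1` [set` l])); split.
    + apply: measurableC; exact: measurable_preimage_discrete.
    + exact: uniform_support.
    + move=> w /=; rewrite /setC /= => Nw Wl; apply: Nw => _.
      by rewrite finite_partE // Wl.
rewrite integral_finite_part // mulr_suml -sumEFin [RHS]big_mkcond.
apply: eq_big_seq => s /W_unif e /=; case: ifP => As.
  rewrite setIidl ?e //.
  by move=> w /= ->.
rewrite (_ : _ `&` _ = set0) ?measure0 ?mule0 //.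
by apply/seteqP; split=> [w [/= ->]|//]; rewrite As.
Qed.

Lemma expectation_uniform_seq (g : S -> R) : 'E_P[fun w => (g (W w))%R]%E = (avg g l)%:E.
Proof.
rewrite unlock -(integral_uniform_seq xpredT g); congr (integral _ _ _).
by apply/seteqP.
Qed.

Lemma probability_uniform_seq (A : pred S) :
  P (W @^-1` [set s | A s]) = ((count A l)%:R / (size l)%:R)%:E.
Proof.
have mA := measurable_preimage_discrete [set s | A s].
have := integral_uniform_seq A (fun=> 1).
by rewrite integral_cst // mul1e => ->; rewrite -sum1_count natr_sum.
Qed.
End uniform.
End discrete.

(** * Fringe trees of a fixed tree *)

Lemma ptree_nested_ind (Q : ptree -> Prop) :
  (forall ts, {in ts, forall t, Q t} -> Q (PNode ts)) -> forall t, Q t.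
Proof.
move=> QS t; suff : {in [:: t], forall u, Q u} by apply; rewrite inE.
(* The statement for all the trees of a forest follows the exploration. *)
elim/forest_ind: [:: t] => // ts fs IH u; rewrite inE => /orP[/eqP ->|ufs].
  by apply: QS => v vts; apply: IH; rewrite mem_cat vts.
by apply: IH; rewrite mem_cat ufs orbT.
Qed.

Lemma uniq_vertices t : uniq (vertices t).
Proof.
elim/ptree_nested_ind: t => ts uts /=.
pose sub a (us : seq ptree) := flatten [seq [seq (iv.1 :: v : address) | v <- iv.2]
  | iv <- zip (iota a (size us)) (map vertices us)].
(* Addresses with different first entries cannot coincide. *)
have sub_head us a v : v \in sub a us -> exists i w, v = i :: w /\ (a <= i)%N.
  elim: us a => [//|u us IH] a; rewrite /sub /= mem_cat => /orP[/mapP[w _ ->]|].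
    by exists a, w.
  by move=> /IH[i [w [-> ai]]]; exists i, w; split=> //; exact: ltnW.
apply/andP; split.
  by apply/negP => /(sub_head ts 0%N)[i [w []]].
rewrite -/(sub 0%N ts); elim: ts 0%N uts => [//|u us IH] a uts.
rewrite /sub /= cat_uniq map_inj_uniq => [|v w []] //.
rewrite uts ?mem_head //= IH ?andbT => [|v vus]; last by rewrite uts // inE vus orbT.
apply/hasPn => _ /sub_head[i [w [-> ai]]]; apply/mapP => -[v _ [ia _]].
by rewrite ia ltnn in ai.
Qed.

Definition fringes (t : ptree) : seq ptree := [seq fringe t v | v <- vertices t].

Lemma size_fringes t : size (fringes t) = Defs.tsize t.
Proof. exact: size_map. Qed.

Section fringes.
Variable R : realType.
Implicit Types f : ptree -> R.

Lemma avg_fringes_pred1 (T t : ptree) :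
  avg (fun u => (u == T)%:R : R) (fringes t) = (fringe_count T t)%:R / (Defs.tsize t)%:R.
Proof.
rewrite /avg size_fringes -natr_sum big_map; congr (_%:R / _).
by rewrite /fringe_count -sum1_count [RHS]big_mkcond; apply: eq_bigr => v _; case: eqP.
Qed.

(** The analogue of [expectation_head] for the uniform law on a list. *)
Lemma avg_head (S : eqType) (f : S -> R) C (K l : seq S) :
  uniq K -> (forall s, `|f s| <= C) -> (0 < size l)%N ->
  `|avg f l - \sum_(s <- K) f s * avg (fun u => (u == s)%:R) l| <=
  C * (1 - \sum_(s <- K) avg (fun u => (u == s)%:R) l).
Proof.
move=> uK fC l0.
have ind (g : S -> R) u : \sum_(s <- K) g s * (u == s)%:R = if u \in K then g u else 0.
  elim: (K) uK => [|s K' IH] /=; first by rewrite big_nil.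
  move=> /andP[sK /IH {}IH]; rewrite big_cons IH inE.
  have [->|us] := eqVneq u s; first by rewrite (negbTE sK) mulr1 addr0.
  by rewrite mulr0 add0r.
have -> : avg f l - \sum_(s <- K) f s * avg (fun u => (u == s)%:R) l =
    avg (fun u => f u + -1 * \sum_(s <- K) f s * (u == s)%:R) l.
  rewrite avgD avgZ mulN1r avg_sum; congr (_ - _).
  by apply: eq_bigr => s _; rewrite avgZ.
have -> : C * (1 - \sum_(s <- K) avg (fun u => (u == s)%:R) l) =
    avg (fun u => C * (1 + -1 * \sum_(s <- K) 1 * (u == s)%:R)) l.
  rewrite avgZ avgD avg_cst // avgZ mulN1r avg_sum; congr (_ * (_ - _)).
  by apply: eq_bigr => s _; rewrite avgZ mul1r.
apply: le_trans (ler_norm_avg _ _) _; apply: ler_avg => u _.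
rewrite !ind !mulN1r; case: ifP => _; first by rewrite !subrr normr0 mulr0.
by rewrite !subr0 mulr1.
Qed.

(** Comparison of a mean over the list [l] with a number [m] that is close to
    the mean under the weights [q]. The mass that [l] puts outside [K] is
    one minus its mass on [K], so it is controlled by the errors on [K] too; hence
    the two factors 2. *)
Lemma avg_dist_head (S : eqType) (f q : S -> R) C m (K l : seq S) :
  uniq K -> (forall s, `|f s| <= C) -> (0 < size l)%N ->
  `|m - \sum_(s <- K) f s * q s| <= C * (1 - \sum_(s <- K) q s) ->
  `|avg f l - m| <= 2 * C * \sum_(s <- K) `|avg (fun u => (u == s)%:R) l - q s|
    + 2 * C * (1 - \sum_(s <- K) q s).
Proof.
move=> uK fC l0 mK.
pose mu s := avg (fun u => (u == s)%:R) l : R.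
have muK := avg_head uK fC l0.
have C0 : 0 <= C.
  by case: (l) l0 => [//|u _ _]; apply: le_trans (fC u).
have d1 : `|\sum_(s <- K) f s * mu s - \sum_(s <- K) f s * q s| <=
    C * \sum_(s <- K) `|mu s - q s|.
  rewrite -sumrB mulr_sumr; apply: le_trans (ler_norm_sum _ _ _) _.
  apply: ler_sum => s _; rewrite -mulrBr normrM ler_wpM2r //.
have d2 : \sum_(s <- K) q s - \sum_(s <- K) mu s <= \sum_(s <- K) `|mu s - q s|.
  rewrite -sumrB; apply: ler_sum => s _; rewrite distrC; exact: ler_norm.
have d3 := ler_wpM2l C0 d2.
move: muK mK d1 d3; rewrite -/mu !ler_norml !mulrBr.
move: (avg f l) (\sum_(s <- K) f s * mu s) (\sum_(s <- K) f s * q s) => a x y.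
move: (\sum_(s <- K) q s) (\sum_(s <- K) mu s) (\sum_(s <- K) `|mu s - q s|) => u v w.
by move=> /andP[? ?] /andP[? ?] /andP[? ?] ?; apply/andP; split; lra.
Qed.

End fringes.

Section quenched_limit.
Variables (R : realType) (n : nat -> nat -> nat) (p : nat -> R) (L : nat -> seq ptree).
Hypothesis n_stat : forall k, (0 < k)%N -> degree_statistic (n k).
Hypothesis n_size : dsize (n k) @[k --> \oo] --> \oo.
Hypothesis n_cvg : forall i, (n k i)%:R / (dsize (n k))%:R @[k --> \oo] --> p i.
Hypothesis L_uniq : forall k, (0 < k)%N -> uniq (L k).
Hypothesis mem_L : forall k, (0 < k)%N -> forall t, t \in L k <-> trees_with (n k) t.

(** Scheffe's argument: convergence of the proportion of each single tree
    suffices, because the limit loses no mass. *)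
Lemma cvg_avg_fringes (f : ptree -> R) (C m : R) : (forall t, `|f t| <= C) ->
  (forall e, 0 < e -> exists2 K, uniq K & 1 - e < \sum_(T <- K) gw_law p T) ->
  (forall K, uniq K -> `|m - \sum_(T <- K) f T * gw_law p T| <=
    C * (1 - \sum_(T <- K) gw_law p T)) ->
  avg (fun t => `|avg f (fringes t) - m|) (L k) @[k --> \oo] --> 0.
Proof.
move=> fC heads mK; have C0 : 0 <= C by apply: le_trans (fC (PNode [::])).
apply/cvgr0Pnorm_le => e e0.
(* The tail then contributes at most 2 C e / (4 (C + 1)), below e / 2; adding 1 to
   C avoids a division by zero. *)
have C1 : 0 < 4 * (C + 1) by lra.
have [K uK pK] := heads (e / (4 * (C + 1))) (divr_gt0 e0 C1).
have dev_cvg : 2 * C * \sum_(T <- K) avg (fun t => `|(fringe_count T t)%:R /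
    (dsize (n k))%:R - gw_law p T|) (L k) @[k --> \oo] --> 0.
  rewrite -[X in _ --> X](mulr0 (2 * C)); apply: cvgM; first exact: cvg_cst.
  rewrite -[X in _ --> X](_ : \sum_(T <- K) 0 = 0); last by rewrite big1.
  apply: cvg_big => [|T _]; first exact: add_continuous.
  exact: (cvg_avg_abs_gw n_stat n_size n_cvg L_uniq mem_L).
near=> k.
have k0 : (0 < k)%N by near: k; exact: nbhs_infty_gt.
rewrite ger0_norm; last by rewrite mulr_ge0 ?invr_ge0 // sumr_ge0.
have dev_le : 2 * C * \sum_(T <- K) avg (fun t => `|(fringe_count T t)%:R /
    (dsize (n k))%:R - gw_law p T|) (L k) <= e / 2.
  near: k; apply: (cvgr_le _ dev_cvg); lra.
pose dev t := 2 * C *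
  \sum_(T <- K) `|(fringe_count T t)%:R / (dsize (n k))%:R - gw_law p T|.
apply: (@le_trans _ _
  (avg (fun t => dev t + 2 * C * (1 - \sum_(T <- K) gw_law p T)) (L k))).
  apply: ler_avg => t tL.
  have size_t : (0 < size (fringes t))%N by rewrite size_fringes; case: (t).
  apply: le_trans (avg_dist_head uK fC size_t (mK K uK)) _.
  rewrite lerD2r; apply: ler_wpM2l; first by rewrite mulr_ge0.
  apply: ler_sum => T _.
  by rewrite avg_fringes_pred1 (tsize_L n_stat mem_L k0 tL).
rewrite avgD avg_cst ?(size_L_gt0 n_stat mem_L) // {}/dev avgZ avg_sum.
have : 2 * C * (1 - \sum_(T <- K) gw_law p T) <= e / 2.
  apply: (@le_trans _ _ (2 * C * (e / (4 * (C + 1))))).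
    by apply: ler_wpM2l; [rewrite mulr_ge0|lra].
  rewrite mulrA ler_pdivrMr //; nra.
lra.
Unshelve. all: by end_near. Qed.

End quenched_limit.

(** * A uniform vertex of a uniform tree *)

Section random_fringe.
Context {R : realType} {d : measure_display} {Omega : measurableType d}.
Variables (P : probability Omega R) (X : {RV P >-> ptree}) (V : {RV P >-> address}).
Variables (n : nat -> nat) (L : seq ptree).
Hypothesis L_uniq : uniq L.
Hypothesis L_gt0 : (0 < size L)%N.
Hypothesis mem_L : forall t, t \in L <-> trees_with n t.
Hypothesis tsize_L : {in L, forall t, Defs.tsize t = dsize n}.
Hypothesis X_unif : uniform_on P X (trees_with n).
Hypothesis V_unif : uniform_vertex P X V.

Let N_gt0 : (0 < dsize n)%N.
Proof. by case: L L_gt0 tsize_L => [//|t l] _ /(_ t (mem_head _ _)) <-; case: t. Qed.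

Lemma uniform_tree_law t : t \in L -> P (X @^-1` [set t]) = ((size L)%:R^-1)%:E.
Proof.
move=> tL; rewrite X_unif mem_set; last exact/mem_L.
congr ((_%:R^-1)%:E).
have -> : trees_with n = [set` L] by apply/seteqP; split=> u /mem_L.
rewrite (_ : fset_set _ = [fset u in L]%fset).
  by rewrite card_fseq undup_id.
by apply/fsetP => u; rewrite in_fset_set //= !inE mem_setE.
Qed.

Lemma measurable_tree t : measurable (X @^-1` [set t]).
Proof. exact: measurable_funPTI. Qed.

Let W w : ptree * address := (X w, V w).

Lemma preimage_tree_vertex s :
  W @^-1` [set s] = X @^-1` [set s.1] `&` V @^-1` [set s.2].
Proof.
apply/seteqP; split=> w; rewrite /W /preimage /=; first by move=> <-.
by move=> [-> ->]; case: s.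
Qed.

Lemma measurable_tree_vertex s : measurable (W @^-1` [set s]).
Proof.
by rewrite preimage_tree_vertex; apply: measurableI; exact: measurable_funPTI.
Qed.

(** The pair of the random tree and the random vertex is uniform on this list,
    because all the trees of [L] have the same size. *)
Definition pointed_trees : seq (ptree * address) :=
  [seq (t, v) | t <- L, v <- vertices t].

Lemma uniq_pointed_trees : uniq pointed_trees.
Proof.
apply: allpairs_uniq_dep => //; first by move=> t _; exact: uniq_vertices.
by move=> [t v] [u w] _ _ /= [-> ->].
Qed.

Lemma size_pointed_trees : size pointed_trees = (size L * dsize n)%N.
Proof.
rewrite size_allpairs_dep sumnE big_map (eq_big_seq (fun=> dsize n)) //.
by rewrite big_const_seq count_predT iter_addn_0 mulnC.
Qed.

Lemma size_pointed_trees_gt0 : (0 < size pointed_trees)%N.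
Proof. by rewrite size_pointed_trees muln_gt0 L_gt0. Qed.

Lemma pointed_tree_law s : s \in pointed_trees ->
  P (W @^-1` [set s]) = ((size pointed_trees)%:R^-1)%:E.
Proof.
move=> /allpairsPdep[t [v [tL vt ->]]].
rewrite preimage_tree_vertex V_unif vt uniform_tree_law // tsize_L //.
by rewrite -EFinM size_pointed_trees natrM invfM.
Qed.

Lemma avg_pointed_trees (f : ptree -> R) :
  avg (fun s => f (fringe s.1 s.2)) pointed_trees = avg (fun t => avg f (fringes t)) L.
Proof.
rewrite /avg big_allpairs_dep size_pointed_trees natrM invfM mulrA mulrAC mulr_suml.
congr (_ / _); apply: eq_big_seq => t tL.
by rewrite size_fringes tsize_L // big_map.
Qed.

Lemma measurable_fringe (A : set ptree) :
  measurable ((fun w => fringe (X w) (V w)) @^-1` A).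
Proof.
exact: (measurable_preimage_discrete measurable_tree_vertex [set s | A (fringe s.1 s.2)]).
Qed.

Lemma expectation_fringe (f : ptree -> R) :
  'E_P[fun w => f (fringe (X w) (V w))]%E = (avg (fun t => avg f (fringes t)) L)%:E.
Proof.
rewrite -avg_pointed_trees.
exact: (expectation_uniform_seq measurable_tree_vertex uniq_pointed_trees
  size_pointed_trees_gt0 pointed_tree_law (fun s => f (fringe s.1 s.2))).
Qed.

Lemma expectation_tree (g : ptree -> R) : 'E_P[fun w => g (X w)]%E = (avg g L)%:E.
Proof.
exact: (expectation_uniform_seq measurable_tree L_uniq L_gt0 uniform_tree_law g).
Qed.

Lemma probability_fringe T : P ((fun w => fringe (X w) (V w)) @^-1` [set T]) =
  (avg (fun t => (fringe_count T t)%:R / (dsize n)%:R) L)%:E.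
Proof.
rewrite -[LHS]expectation_indic; last exact: measurable_fringe.
have -> : \1_((fun w => fringe (X w) (V w)) @^-1` [set T]) =
    (fun w => (fringe (X w) (V w) == T)%:R) :> (Omega -> R).
  apply/funext => w; rewrite indicE; case: eqP => wT; first by rewrite mem_set.
  by rewrite memNset.
rewrite (expectation_fringe (fun u => (u == T)%:R)); congr EFin.
by apply: eq_avg => t tL; rewrite avg_fringes_pred1 tsize_L.
Qed.

(** The event that the random tree is [t] consists, up to probability zero, of
    the pairs above [t] in [pointed_trees], which are equally likely. *)
Lemma conditional_mean_fringe (f : ptree -> R) t : t \in L ->
  fine (\int[P]_(w in X @^-1` [set t]) (f (fringe (X w) (V w)))%:E)%E /
    fine (P (X @^-1` [set t])) = avg f (fringes t).
Proof.
move=> tL; rewrite uniform_tree_law //.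
have := integral_uniform_seq measurable_tree_vertex uniq_pointed_trees
  size_pointed_trees_gt0 pointed_tree_law (fun s => s.1 == t)
  (fun s => f (fringe s.1 s.2)).
have -> : W @^-1` [set s | s.1 == t] = X @^-1` [set t].
  by apply/seteqP; split=> u /= /eqP.
move=> -> /=; rewrite big_mkcond big_allpairs_dep /= (bigD1_seq t) //=.
rewrite [X in _ + X]big1 ?addr0; last first.
  by move=> u /negbTE ut; rewrite big1 // => v _; rewrite ut.
rewrite eqxx size_pointed_trees natrM invfM invrK /avg size_fringes tsize_L // big_map.
by field; rewrite !pnatr_eq0 -!lt0n L_gt0 N_gt0.
Qed.

Lemma cond_prob_fringe T w : X w \in L ->
  cond_prob P X ((fun u => fringe (X u) (V u)) @^-1` [set T]) w =
  (fringe_count T (X w))%:R / (dsize n)%:R.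
Proof.
move=> XL; rewrite -(tsize_L XL) -avg_fringes_pred1 -conditional_mean_fringe //.
rewrite /cond_prob -integral_indic; first last.
- exact: measurable_fringe.
- exact: measurable_tree.
congr (fine _ / _); apply: eq_integral => u _; congr EFin.
rewrite indicE; case: eqP => uT; first by rewrite mem_set.
by rewrite memNset.
Qed.

Lemma ae_tree_in_list : {ae P, forall w, X w \in L}.
Proof.
exists (~` (X @^-1` [set` L])); split.
- apply: measurableC; exact: (measurable_preimage_discrete measurable_tree).
- exact: (uniform_support measurable_tree L_uniq L_gt0 uniform_tree_law).
- by move=> w.
Qed.

Lemma markov_tree (h : ptree -> R) (eps : R) : (forall t, 0 <= h t) -> 0 < eps ->
  (P [set w | (eps <= h (X w))%R] <= (avg h L / eps)%:E)%E.
Proof.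
move=> h0 e0.
rewrite (_ : [set _ | _] = X @^-1` [set t | eps <= h t]) //.
rewrite (probability_uniform_seq measurable_tree L_uniq L_gt0 uniform_tree_law) lee_fin.
rewrite ler_pdivlMr // /avg mulrAC ler_wpM2r ?invr_ge0 //.
rewrite -sum1_count natr_sum mulr_suml big_mkcond; apply: ler_sum => t _.
by case: ifP => // et; rewrite mul1r.
Qed.

End random_fringe.

(** * Convergence of the random fringe tree *)

Theorem theorem1p3 (R : realType) (n : nat -> nat -> nat) (p : nat -> R)
  (n_stat : forall k, (0 < k)%N -> degree_statistic (n k))
  (n_size : dsize (n k) @[k --> \oo] --> \oo)
  (p_dist : is_distribution p)
  (n_cvg : forall i, (n k i)%:R / (dsize (n k))%:R @[k --> \oo] --> p i)
  (d : nat -> measure_display) (Omega : forall k, measurableType (d k))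
  (P : forall k, probability (Omega k) R)
  (X : forall k, {RV (P k) >-> ptree})
  (X_unif : forall k, (0 < k)%N -> uniform_on (P k) (X k) (trees_with (n k)))
  (V : forall k, {RV (P k) >-> address})
  (V_unif : forall k, (0 < k)%N -> uniform_vertex (P k) (X k) (V k)) :
  let Xfr := fun k (w : Omega k) => fringe (X k w) (V k w) in
  (forall T : ptree,
    (* (i) *)
    ((forall k, (0 < k)%N ->
        P k (Xfr k @^-1` [set T]) =
        ('E_(P k)[fun w => (fringe_count T (X k w))%:R] *
         ((dsize (n k))%:R^-1)%:E)%E) /\
     P k (Xfr k @^-1` [set T]) @[k --> \oo] --> (gw_law p T)%:E) /\
    (* (ii) *)
    ((forall k, (0 < k)%N ->
        {ae P k, forall w, cond_prob (P k) (X k) (Xfr k @^-1` [set T]) w =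
           (fringe_count T (X k w))%:R / (dsize (n k))%:R}) /\
     cvg_in_prob P
       (fun k w => (fringe_count T (X k w))%:R / (dsize (n k))%:R)
       (gw_law p T))) /\
  (* convergence in distribution to the Galton-Watson tree *)
  (forall (d0 : measure_display) (Omega0 : measurableType d0)
     (P0 : probability Omega0 R) (Tp : {RV P0 >-> ptree}),
     (forall t, P0 (Tp @^-1` [set t]) = (gw_law p t)%:E) ->
     cvg_in_dist P P0 Tp Xfr /\ cond_law_cvg_in_prob P P0 Tp X Xfr).
Proof.
move=> Xfr.
have /choice[L HL] : forall k, exists L : seq ptree, (0 < k)%N ->
    uniq L /\ forall t, t \in L <-> trees_with (n k) t.
  move=> k; case: (posnP k) => [->|k0]; first by exists [::].
  have [B /(_ B (leqnn B))[stat _]] := degree_statistic_bound (n_stat k k0).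
  exists (trees B (n k)) => _; split; first exact: uniq_trees.
  by move=> t; exact: mem_trees.
have L_uniq k (k0 : (0 < k)%N) := (HL k k0).1.
have mem_L k (k0 : (0 < k)%N) := (HL k k0).2.
have L_gt0 k (k0 : (0 < k)%N) : (0 < size (L k))%N by exact: (size_L_gt0 n_stat mem_L k0).
have size_L k (k0 : (0 < k)%N) : {in L k, forall t, Defs.tsize t = dsize (n k)}.
  by move=> t; exact: (tsize_L n_stat mem_L k0).
pose freq T k t : R := (fringe_count T t)%:R / (dsize (n k))%:R.
have L1 T : avg (fun t => `|freq T k t - gw_law p T|) (L k) @[k --> \oo] --> 0.
  exact: (cvg_avg_abs_gw n_stat n_size n_cvg L_uniq mem_L).
have avg_cvg (h : nat -> ptree -> R) c :
    avg (fun t => `|h k t - c|) (L k) @[k --> \oo] --> 0 ->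
    avg (h k) (L k) @[k --> \oo] --> c.
  move=> hc; apply/cvgrPdist_le => e e0; near=> k.
  have k0 : (0 < k)%N by near: k; exact: nbhs_infty_gt.
  have -> : c - avg (h k) (L k) = - avg (fun t => h k t + - c) (L k).
    by rewrite avgD avg_cst ?L_gt0 // opprD opprK addrC.
  rewrite normrN; apply: le_trans (ler_norm_avg _ _) _.
  near: k; exact: (cvgr_le _ hc).
have prob_cvg (h : nat -> ptree -> R) c :
    avg (fun t => `|h k t - c|) (L k) @[k --> \oo] --> 0 ->
    cvg_in_prob P (fun k w => h k (X k w)) c.
  move=> hc eps e0.
  have up : (avg (fun t => `|h k t - c|) (L k) / eps)%:E @[k --> \oo] --> 0%E.
    apply: cvg_EFin; first exact: nearW.
    rewrite -(mul0r eps^-1); apply: cvgM => //; exact: cvg_cst.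
  apply: (squeeze_cvge _ _ up); last exact: cvg_cst.
  near=> k; rewrite measure_ge0 /=.
  have k0 : (0 < k)%N by near: k; exact: nbhs_infty_gt.
  exact: (markov_tree (L_uniq k k0) (L_gt0 k k0) (mem_L k k0) (X_unif k k0)).
split=> [T|d0 Omega0 P0 Tp Tp_law].
  have P_fr k : (0 < k)%N -> P k (Xfr k @^-1` [set T]) = (avg (freq T k) (L k))%:E.
    move=> k0.
    exact: (probability_fringe (L_uniq k k0) (L_gt0 k k0) (mem_L k k0) (size_L k k0)
      (X_unif k k0) (V_unif k k0)).
  split; split.
  - move=> k k0; rewrite P_fr // (expectation_tree (L_uniq k k0) (L_gt0 k k0) (mem_L k k0)
      (X_unif k k0) (fun t => (fringe_count T t)%:R)).
    rewrite -EFinM; congr EFin; rewrite mulrC -avgZ.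
    by apply: eq_avg => t _; rewrite mulrC.
  - apply: (@cvg_trans _ ((avg (freq T k) (L k))%:E @[k --> \oo])).
      by apply: near_eq_cvg; near=> k; rewrite P_fr //; near: k; exact: nbhs_infty_gt.
    by apply: cvg_EFin; [exact: nearW|exact: avg_cvg].
  - move=> k k0.
    apply: filterS (ae_tree_in_list (L_uniq k k0) (L_gt0 k k0) (mem_L k k0)
      (X_unif k k0)) => w XL.
    exact: (cond_prob_fringe (L_uniq k k0) (L_gt0 k k0) (mem_L k k0) (size_L k k0)
      (X_unif k k0) (V_unif k k0)).
  - exact: (prob_cvg (freq T)).
have mTp := measurable_tree Tp.
have massE t : pmass P0 Tp t = gw_law p t by rewrite /pmass Tp_law.
suff main (f : ptree -> R) : bounded_fun f ->
    avg (fun t => `|avg f (fringes t) - fine 'E_P0[f \o Tp]%E|) (L k)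
      @[k --> \oo] --> 0 /\
    'E_P0[f \o Tp]%E \is a fin_num.
  split=> f bf; have [L1f fin] := main f bf.
    apply: (@cvg_trans _ ((avg (fun t => avg f (fringes t)) (L k))%:E @[k --> \oo])).
      apply: near_eq_cvg; near=> k.
      have k0 : (0 < k)%N by near: k; exact: nbhs_infty_gt.
      by rewrite -(expectation_fringe (L_uniq k k0) (L_gt0 k k0) (mem_L k k0)
        (size_L k k0) (X_unif k k0) (V_unif k k0)).
    rewrite -(fineK fin); apply: cvg_EFin; first exact: nearW.
    exact: (avg_cvg (fun _ t => avg f (fringes t))).
  (* The conditional expectation depends on the outcome through the tree only. *)
  pose H k t := fine (\int[P k]_(u in X k @^-1` [set t]) ((f \o Xfr k) u)%:E)%E
    / fine (P k (X k @^-1` [set t])).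
  apply: (prob_cvg H).
  apply: cvg_trans L1f; apply: near_eq_cvg; near=> k.
  have k0 : (0 < k)%N by near: k; exact: nbhs_infty_gt.
  apply: eq_avg => t tL; rewrite /H (conditional_mean_fringe (L_uniq k k0) (L_gt0 k k0)
    (mem_L k k0) (size_L k k0) (X_unif k k0) (V_unif k k0)) //.
move=> [M [_ HM]].
have fC t : `|f t| <= `|M| + 1.
  by apply: HM => //; rewrite ltr_pwDr // ler_norm.
split.
  apply: (cvg_avg_fringes n_stat n_size n_cvg L_uniq mem_L fC).
    move=> e e0; have [K uK hK] := exists_head P0 mTp e0.
    by exists K => //; under eq_bigr do rewrite -massE.
  move=> K uK; have := expectation_head P0 mTp uK fC.
  under eq_bigr do rewrite massE.
  by under [X in _ * (1 - X)]eq_bigr do rewrite massE.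
rewrite unlock; apply: integrable_fin_num => //.
exact: integrable_bounded fC.
Unshelve. all: by end_near. Qed.
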